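(* Let $\mathfrak{F}:\mathbf{f}\subset R=k[X_0,\ldots,X_n]/\mathfrak{a}$ be an $m$-targeted rational map of degree $d$, with $S=k[Y_0,\ldots,Y_m]/\mathfrak{b}\simeq k[\mathbf{f}]$. The following conditions are equivalent: (a) $\mathfrak{F}:\mathbf{f}\subset R$ is birational onto the image; (b) For every minimal prime $P$ of $R$, the induced $m$-targeted rational map $\mathfrak{F}|_P:\bar{\mathbf{f}}\subset\bar R=R/P$ is birational onto its image and, moreover, $R/P$ is the unique minimal component of $R$ mapping to the latter by $\mathfrak{F}$ (i.e. $P$ is the only minimal prime of $R$ contracting to $P\cap k[\mathbf{f}]$); (c) The induced homomorphism in degree zero $K(S)_0\hookrightarrow K(R)_0$ is an isomorphism; (d) The induced homogeneous homomorphism $K(S)\hookrightarrow K(R^{(d)})$ is an isomorphism.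
   Context: Setting. $k$ is an arbitrary field; $R=k[X_0,\ldots,X_n]/\mathfrak{a}=k[x_0,\ldots,x_n]$ is a reduced standard graded $k$-algebra ($\mathfrak{a}$ homogeneous) with $\dim R\ge 1$. For such a graded ring, $K(R)$ denotes the homogeneous total ring of quotients, i.e. the ring of fractions of $R$ with respect to the set of homogeneous regular elements; $K(R)_0$ is its degree-zero part. $R^{(d)}=\bigoplus_i R_{id}$ is the $d$th Veronese subring, regraded to be standard. Rational maps. Two ordered sets $\mathbf{f}=\{f_0,\ldots,f_m\}$, $\mathbf{f}'=\{f'_0,\ldots,f'_m\}$ of forms in $R$ (each set consisting of forms of one same degree) are equivalent if there are regular homogeneous elements $F,F'\in R$ with $Ff'_j=F'f_j$ for all $j$. A rational $(m+1)$-datum of degree $d$ on $R$ is an ordered set $\mathbf{f}=\{f_0,\ldots,f_m\}\subset R$ of forms of the same degree $d\geq 1$ such that (1) $R$ is torsionfree over the subring $k[\mathbf{f}]$ (i.e. every minimal prime of $R$ contracts to a minimal prime of $k[\mathbf{f}]$), and (2) the ideal $(\mathbf{f})R$ is not contained in any minimal prime of $R$. An $m$-targeted rational map $\mathfrak{F}$ with source $\mathrm{Proj}(R)$ is an equivalence class of rational $(m+1)$-data; one writes $\mathfrak{F}:\mathbf{f}\subset R$ for a representative $\mathbf{f}$, and $d$ is the degree of this representative. All representatives share a common standard graded presentation $S=k[Y_0,\ldots,Y_m]/\mathfrak{b}\simeq k[\mathbf{f}]$, $Y_j\mapsto f_j$ (after degree renormalization); $\mathrm{Proj}(S)\subset\mathbb{P}^m_k$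 is the image. Since $R$ is torsionfree over $S\simeq k[\mathbf{f}]$, the inclusion $S\hookrightarrow R$ induces injections $K(S)\hookrightarrow K(R^{(d)})$ (homogeneous of degree $0$) and $K(S)_0\hookrightarrow K(R)_0$. For a minimal prime $P$ of $R$, the residues $\bar{\mathbf{f}}$ of $\mathbf{f}$ in $R/P$ form a rational datum on $R/P$, whose image is $\mathrm{Proj}(k[\mathbf{f}]/(P\cap k[\mathbf{f}]))$; this is the map $\mathfrak{F}|_P$. Birationality. $\mathfrak{F}:\mathbf{f}\subset R$ is birational (onto the image) if there is an $n$-targeted rational map $\mathfrak{G}:\mathbf{g}=\{g_0,\ldots,g_n\}\subset S$ such that $\mathbf{g}(\mathbf{f})=\{g_0(\mathbf{f}),\ldots,g_n(\mathbf{f})\}\subset R$ is equivalent to $\{x_0,\ldots,x_n\}$. *)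

(* Defs.v *)
From HB Require Import structures.
From mathcomp Require Import all_boot all_order all_algebra.
From mathcomp Require Import generic_quotient ring_quotient.
From mathcomp Require Import mpoly ring.
From mathcomp Require Import boolp classical_sets.

Set Implicit Arguments.
Unset Strict Implicit.
Unset Printing Implicit Defensive.

Import GRing.Theory.
Local Open Scope ring_scope.
Local Open Scope quotient_scope.

Section Primes.
Variable A : comNzRingType.

Definition reduced := forall (a : A) (e : nat), a ^+ e = 0 -> a = 0.

Definition is_prime (P : {pred A}) :=
  idealr_closed P /\ prime_idealr_closed P.

Definition minimal_prime (P : {pred A}) :=
  is_prime P /\
  forall Q : {pred A}, is_prime Q -> {subset Q <= P} -> {subset P <= Q}.

(* a chain P_0 < ... < P_r; values of P beyond r are irrelevant *)
Definition krull_dim_ge (r : nat) :=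
  exists P : nat -> {pred A},
    (forall i, (i <= r)%N -> is_prime (P i)) /\
    (forall i, (i < r)%N ->
       {subset P i <= P i.+1} /\ ~ {subset P i.+1 <= P i}).

Lemma reduced_mulX (s x : A) (e : nat) :
  reduced -> s * x ^+ e.+1 = 0 -> s * x = 0.
Proof.
move=> redA sx0; apply: (redA _ e.+1).
by rewrite exprMn exprS -mulrA mulrCA sx0 mulr0.
Qed.

Let mulset (M : set A) :=
  [/\ M 1, (forall x y, M x -> M y -> M (x * y)) & ~ M 0].

Lemma exists_minimal_prime (M : set A) : reduced -> mulset M ->
  exists2 P : {pred A}, minimal_prime P & forall x, M x -> x \notin P.
Proof.
move=> redA [M1 MM M0].
have [F FN totF|B0 [mB maxB]] := @Zorn_bigcup _
    (fun X : set A => mulset (X `|` M)%classic).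
  split; first by right.
  - have closed X x y : F X -> (X `|` M)%classic x -> (X `|` M)%classic y ->
        (\bigcup_(X in F) X `|` M)%classic (x * y).
      move=> FX Xx Xy; have [_ XM _] := FN _ FX.
      by case: (XM _ _ Xx Xy) => ?; [left; exists X | right].
    move=> x y [[X FX Xx]|Mx] [[Y FY Yy]|My].
    + by have [XY|YX] := totF _ _ FX FY; [apply: (closed Y)|apply: (closed X)];
        rewrite //; left; [exact: XY | | | exact: YX].
    + by apply: (closed X) => //; [left|right].
    + by apply: (closed Y) => //; [right|left].
    + by right; apply: MM.
  - by case=> [[X FX X0]|//]; have [_ _ []] := FN _ FX; left.
pose B := (B0 `|` M)%classic; have [B1 BM B_0] : mulset B := mB.
have annB x : ~ B x -> exists2 s, B s & s * x = 0.
  move=> Bx; apply: contrapT => noann.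
  pose C := [set y | exists2 s, B s & exists e, y = s * x ^+ e]%classic.
  have BC : (B `<=` C)%classic.
    by move=> y By; exists y => //; exists 0%N; rewrite expr0 mulr1.
  have Cx : C x by exists 1 => //; exists 1%N; rewrite mul1r expr1.
  have CM : (C `|` M = C)%classic.
    by apply/seteqP; split=> [y [//|My]|y]; [apply: BC; right | left].
  apply: (maxB C).
    split=> [y B0y|CB]; first by apply: BC; left.
    by apply: Bx; left; apply: CB.
  rewrite CM; split; first exact: BC.
  - move=> _ _ [s Bs [e ->]] [t Bt [e' ->]]; exists (s * t); first exact: BM.
    by exists (e + e')%N; rewrite exprD mulrACA.
  - case=> s Bs [[|e]] /esym; first by rewrite expr0 mulr1 => s0; rewrite s0 in Bs.
    by move=> /(reduced_mulX redA) sx0; apply: noann; exists s.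
pose P : {pred A} := fun x => ~~ `[< B x >].
have PE x : x \in P = ~~ `[< B x >] by [].
have inP x : reflect (~ B x) (x \in P).
  by rewrite PE; apply: (iffP negP); apply: contra_not => /asboolP.
have killP x s : B s -> s * x = 0 -> x \in P.
  by move=> Bs sx0; apply/inP => Bx; apply: B_0; rewrite -sx0; apply: BM.
exists P; last by move=> x Mx; apply/negP => /inP; apply; right.
split; first split.
- split; [exact/inP|by apply/negP => /inP|].
  move=> a u v /inP/annB[s Bs su0] /inP/annB[t Bt tv0].
  apply: (killP _ (s * t)); first exact: BM.
  by rewrite mulrDr [s * t * (a * u)]mulrCA -[s * t * v]mulrA tv0 mulr0 addr0
    [s * t]mulrC -[t * s * u]mulrA su0 !mulr0.
- move=> x y /inP Bxy; rewrite !PE -negb_and; apply/negP => /andP[].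
  by move=> /asboolP Bx /asboolP By; apply: Bxy; apply: BM.
- move=> Q [[Q0 _ _] prQ] QP x /inP/annB[s Bs sx0].
  have /prQ/orP[/QP/inP//|//] : s * x \in Q by rewrite sx0.
Qed.

Lemma minimal_prime_nonreg (P : {pred A}) (s : A) :
  reduced -> minimal_prime P -> s \in P -> ~ GRing.lreg s.
Proof.
move=> redA [[[P0 P1 PM] prP] minP] sP regs.
have [[u uP us0]|noann] := pselect (exists2 u, u \notin P & s * u = 0).
  by move: uP; rewrite (regs u 0) ?P0 // us0 mulr0.
pose M := [set x | exists2 u, u \notin P & exists e, x = u * s ^+ e]%classic.
have [||Q [prQ _] QM] := @exists_minimal_prime M; rewrite //.
  split; first by exists 1 => //; exists 0%N; rewrite expr0 mulr1.
  - move=> _ _ [u uP [e ->]] [v vP [e' ->]]; exists (u * v).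
      by apply/negP => /prP; rewrite (negPf uP) (negPf vP).
    by exists (e + e')%N; rewrite exprD mulrACA.
  - case=> u uP [[|e]] /esym; first by rewrite expr0 mulr1 => u0; rewrite u0 P0 in uP.
    by move=> /(reduced_mulX redA) us0; apply: noann; exists u; rewrite // mulrC.
have /(minP Q prQ)/(_ s sP) : {subset Q <= P}.
  move=> x Qx; apply/contraLR: Qx => xP; apply: QM; exists x => //.
  by exists 0%N; rewrite expr0 mulr1.
by apply/negP; apply: QM; exists 1 => //; exists 1%N; rewrite mul1r expr1.
Qed.

Lemma reg_of_minimal_primes (s : A) : reduced ->
  (forall P, minimal_prime P -> s \notin P) -> GRing.lreg s.
Proof.
move=> redA sP.
suff reg0 x : s * x = 0 -> x = 0.
  by move=> x y /eqP; rewrite -subr_eq0 -mulrBr => /eqP/reg0/eqP; rewrite subr_eq0 => /eqP.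
move=> sx0; apply/eqP; apply/negPn/negP => x0.
have [||P minP PM] := @exists_minimal_prime (range (fun e => x ^+ e)); rewrite //.
  split; first by exists 0%N.
  - by move=> _ _ [e _ <-] [e' _ <-]; exists (e + e')%N; rewrite // exprD.
  - by case=> e _ /redA/eqP; rewrite (negPf x0).
have [[[P0 _ _] prP] _] := minP.
have /prP : s * x \in P by rewrite sx0.
by rewrite (negPf (sP _ minP)) (negPf (PM _ _)) //; exists 1%N; rewrite ?expr1.
Qed.

End Primes.

(* A family of additive subgroups A_i with 1 in A_0 and A_i A_j in A_(i+j).   *)
(* That A is the direct sum of the A_i is not used to form rings of           *)
(* fractions, so it is not a field of the record.                             *)
Record grading (A : comNzRingType) := Grading {
  gcomp :> nat -> A -> Prop;
  gcomp0 : forall i, gcomp i 0;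
  gcompB : forall i a b, gcomp i a -> gcomp i b -> gcomp i (a - b);
  gcomp1 : gcomp 0 1;
  gcompM : forall i j a b, gcomp i a -> gcomp j b -> gcomp (i + j) (a * b)
}.

Lemma gcompN A (G : grading A) i a : G i a -> G i (- a).
Proof. by move=> Ga; rewrite -sub0r; apply: gcompB => //; apply: gcomp0. Qed.

Lemma gcompD A (G : grading A) i a b : G i a -> G i b -> G i (a + b).
Proof. by move=> Ga Gb; rewrite -[b]opprK; apply: gcompB => //; apply: gcompN. Qed.

Definition homogeneous A (G : grading A) (a : A) := exists i, G i a.

Definition hreg A (G : grading A) (s : A) := homogeneous G s /\ GRing.lreg s.

Module HFrac.
Section HFrac.
Variables (A : comNzRingType) (G : grading A).

Record den := Den { den_val : A; _ : `[< hreg G den_val >] }.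
HB.instance Definition _ := [isSub for den_val].
HB.instance Definition _ := [Choice of den by <:].

Local Notation "'\v' s" := (den_val s) (at level 8, s at level 2).

Lemma denP (s : den) : hreg G (\v s). Proof. by case: s => s /= /asboolP. Qed.
Lemma den_reg (s : den) : GRing.lreg (\v s). Proof. by case: (denP s). Qed.

Lemma hreg1 : hreg G 1.
Proof. by split; [exists 0%N; apply: gcomp1 | apply: lreg1]. Qed.
Lemma hregM s t : hreg G s -> hreg G t -> hreg G (s * t).
Proof.
move=> [[i si] rs] [[j tj] rt]; split; last exact: lregM.
by exists (i + j)%N; apply: gcompM.
Qed.

Definition mkden (s : A) (hs : hreg G s) : den := Den (asboolT hs).
Definition den1 : den := mkden hreg1.
Definition denM (s t : den) : den := mkden (hregM (denP s) (denP t)).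

Definition dom := (A * den)%type.
HB.instance Definition _ := Choice.on dom.

Definition eqf (x y : dom) := x.1 * \v y.2 == y.1 * \v x.2.
Lemma eqf_refl : reflexive eqf. Proof. by move=> x; apply: eqxx. Qed.
Lemma eqf_sym : ssrbool.symmetric eqf. Proof. by move=> x y; apply: eq_sym. Qed.
Lemma eqf_trans : transitive eqf.
Proof.
move=> [b t] [a s] [c u] /eqP /= ab /eqP /= bc; apply/eqP/(@den_reg t) => /=.
have -> : \v t * (a * \v u) = (a * \v t) * \v u by ring.
by rewrite ab mulrAC bc; ring.
Qed.
Canonical eqf_equiv := EquivRel eqf eqf_refl eqf_sym eqf_trans.

Definition type := {eq_quot eqf}.
HB.instance Definition _ : EqQuotient _ eqf type := EqQuotient.on type.
HB.instance Definition _ := Choice.on type.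

Definition frac (a : A) (s : den) : type := \pi_type ((a, s) : dom).

Lemma fracE a s b t : frac a s = frac b t <-> a * \v t = b * \v s.
Proof.
split=> [/eqmodP/eqP //|e].
by apply/eqmodP/eqP.
Qed.

Lemma fracP (x : type) : exists a s, x = frac a s.
Proof. by elim/quotW: x => -[a s]; exists a, s. Qed.

Lemma repr_frac a s :
  (repr (frac a s)).1 * \v s = a * \v (repr (frac a s)).2.
Proof. by apply/fracE; rewrite /frac -surjective_pairing reprK. Qed.

Definition zero : type := frac 0 den1.
Definition one : type := frac 1 den1.
Definition opp (x : type) : type := frac (- (repr x).1) (repr x).2.
Definition add (x y : type) : type :=
  frac ((repr x).1 * \v (repr y).2 + (repr y).1 * \v (repr x).2)
       (denM (repr x).2 (repr y).2).
Definition mul (x y : type) : type :=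
  frac ((repr x).1 * (repr y).1) (denM (repr x).2 (repr y).2).

Lemma oppE a s : opp (frac a s) = frac (- a) s.
Proof. by apply/fracE; rewrite !mulNr repr_frac. Qed.

Lemma addE a s b t :
  add (frac a s) (frac b t) = frac (a * \v t + b * \v s) (denM s t).
Proof.
apply/fracE => /=; have := repr_frac a s; have := repr_frac b t.
move: (repr _) => [b' t'] /= eb; move: (repr _) => [a' s'] /= ea.
transitivity ((a' * \v s) * \v t * \v t' + (b' * \v t) * \v s * \v s'); first by ring.
by rewrite ea eb; ring.
Qed.

Lemma mulE a s b t : mul (frac a s) (frac b t) = frac (a * b) (denM s t).
Proof.
apply/fracE => /=; have := repr_frac a s; have := repr_frac b t.
move: (repr _) => [b' t'] /= eb; move: (repr _) => [a' s'] /= ea.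
transitivity ((a' * \v s) * (b' * \v t)); first by ring.
by rewrite ea eb; ring.
Qed.

Ltac elimf x := let a := fresh "a" in let s := fresh "s" in
  have [a [s ->]] := fracP x.

Lemma addA : associative add.
Proof.
by move=> x y z; elimf x; elimf y; elimf z; rewrite !addE; apply/fracE => /=; ring.
Qed.
Lemma addC : commutative add.
Proof. by move=> x y; elimf x; elimf y; rewrite !addE; apply/fracE => /=; ring. Qed.
Lemma add0x : left_id zero add.
Proof. by move=> x; elimf x; rewrite !addE; apply/fracE => /=; ring. Qed.
Lemma addNx : left_inverse zero opp add.
Proof. by move=> x; elimf x; rewrite oppE !addE; apply/fracE => /=; ring. Qed.
HB.instance Definition _ := GRing.isZmodule.Build type addA addC add0x addNx.

Lemma mulA : associative mul.
Proof.
by move=> x y z; elimf x; elimf y; elimf z; rewrite !mulE; apply/fracE => /=; ring.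
Qed.
Lemma mulC : commutative mul.
Proof. by move=> x y; elimf x; elimf y; rewrite !mulE; apply/fracE => /=; ring. Qed.
Lemma mul1x : left_id one mul.
Proof. by move=> x; elimf x; rewrite !mulE; apply/fracE => /=; ring. Qed.
Lemma mulDx : left_distributive mul add.
Proof.
by move=> x y z; elimf x; elimf y; elimf z; rewrite !(mulE, addE); apply/fracE => /=; ring.
Qed.
Lemma nz1 : one != zero.
Proof. by apply/eqP => /fracE /=; rewrite !mulr1 => /eqP; rewrite oner_eq0. Qed.
HB.instance Definition _ :=
  GRing.Zmodule_isComNzRing.Build type mulA mulC mul1x mulDx nz1.

Lemma fracN a s : - frac a s = frac (- a) s. Proof. exact: oppE. Qed.
Lemma fracD a s b t :
  frac a s + frac b t = frac (a * \v t + b * \v s) (denM s t).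
Proof. exact: addE. Qed.
Lemma fracM a s b t : frac a s * frac b t = frac (a * b) (denM s t).
Proof. exact: mulE. Qed.
Lemma frac1 : 1 = frac 1 den1. Proof. by []. Qed.

End HFrac.
End HFrac.
HB.export HFrac.

(* K(A), the ring of fractions of A with respect to the homogeneous regular   *)
(* elements; hfrac a s is a/s.                                                *)
Notation K := HFrac.type.
Notation hden := HFrac.den.
Notation hfrac := HFrac.frac.
Notation den_val := HFrac.den_val.

Definition Kcomp A (G : grading A) (j : int) (x : K G) :=
  exists (e e' : nat) (a : A) (s : hden G),
    [/\ G e a, G e' (den_val s), j = e%:Z - e'%:Z & x = hfrac a s].

Section K0.
Variables (A : comNzRingType) (G : grading A).

Definition K0_pred : {pred K G} := fun x => `[< Kcomp 0 x >].

Lemma K0P x : x \in K0_pred <->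
  exists e a (s : hden G), [/\ G e a, G e (den_val s) & x = hfrac a s].
Proof.
split=> [/asboolP|[e [a [s [Ga Gs ->]]]]].
  move=> [e [e' [a [s [Ga Gs /esym/eqP]]]]]; rewrite subr_eq0 => /eqP [ee'] ->.
  by exists e, a, s; split=> //; rewrite ee'.
by apply/asboolP; exists e, e, a, s; rewrite subrr.
Qed.

Lemma K0_subring : subring_closed K0_pred.
Proof.
split.
- by apply/K0P; exists 0%N, 1, (HFrac.den1 G); split=> //; apply: gcomp1.
- move=> _ _ /K0P[e [a [s [Ga Gs ->]]]] /K0P[e' [b [t [Gb Gt ->]]]].
  apply/K0P; exists (e + e')%N; rewrite HFrac.fracN HFrac.fracD; do 2!eexists.
  split; last reflexivity; last exact: gcompM.
  by apply: gcompD; [|rewrite addnC]; apply: gcompM => //; apply: gcompN.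
- move=> _ _ /K0P[e [a [s [Ga Gs ->]]]] /K0P[e' [b [t [Gb Gt ->]]]].
  apply/K0P; exists (e + e')%N; rewrite HFrac.fracM; do 2!eexists.
  by split; last reflexivity; apply: gcompM.
Qed.
HB.instance Definition _ := GRing.isSubringClosed.Build (K G) K0_pred K0_subring.

Record K0 := MkK0 { K0_val : K G; _ : K0_val \in K0_pred }.
HB.instance Definition _ := [isSub for K0_val].
HB.instance Definition _ := [Choice of K0 by <:].
HB.instance Definition _ := [SubChoice_isSubComNzRing of K0 by <:].
End K0.

(* Ring maps which multiply degrees by c and send homogeneous regular         *)
(* elements to regular ones: these extend to the rings of fractions.          *)
Record hmorph (c : nat) A (G : grading A) B (H : grading B) := HMorph {
  hm_fun :> {rmorphism A -> B};
  hm_deg : forall i a, G i a -> H (i * c)%N (hm_fun a);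
  hm_reg : forall s, hreg G s -> GRing.lreg (hm_fun s)
}.

Section Kmap.
Variables (c : nat) (A B : comNzRingType) (G : grading A) (H : grading B).
Variable phi : hmorph c G H.

Lemma hm_hreg s : hreg G s -> hreg H (phi s).
Proof.
move=> hs; split; last exact: hm_reg.
by case: hs => -[i si] _; exists (i * c)%N; apply: hm_deg.
Qed.

Definition hm_den (s : hden G) : hden H := HFrac.mkden (hm_hreg (HFrac.denP s)).

Definition Kmap (x : K G) : K H := hfrac (phi (repr x).1) (hm_den (repr x).2).

Lemma KmapE a s : Kmap (hfrac a s) = hfrac (phi a) (hm_den s).
Proof. by apply/HFrac.fracE; rewrite /= -!rmorphM HFrac.repr_frac. Qed.

Lemma Kmap_is_zmod_morphism : zmod_morphism Kmap.
Proof.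
move=> x y; have [a [s ->]] := HFrac.fracP x; have [b [t ->]] := HFrac.fracP y.
rewrite HFrac.fracN HFrac.fracD !KmapE HFrac.fracN HFrac.fracD.
by apply/HFrac.fracE; rewrite /= rmorphD !rmorphM rmorphN.
Qed.
Lemma Kmap_is_monoid_morphism : monoid_morphism Kmap.
Proof.
split=> [|x y].
  by rewrite (HFrac.frac1 G) KmapE; apply/HFrac.fracE => /=; rewrite rmorph1.
have [a [s ->]] := HFrac.fracP x; have [b [t ->]] := HFrac.fracP y.
by rewrite HFrac.fracM !KmapE HFrac.fracM; apply/HFrac.fracE => /=; rewrite !rmorphM.
Qed.
HB.instance Definition _ :=
  GRing.isZmodMorphism.Build (K G) (K H) Kmap Kmap_is_zmod_morphism.
HB.instance Definition _ :=
  GRing.isMonoidMorphism.Build (K G) (K H) Kmap Kmap_is_monoid_morphism.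

Lemma Kmap_deg j x : Kcomp j x -> Kcomp (j * c%:Z) (Kmap x).
Proof.
move=> [e [e' [a [s [Ga Gs -> ->]]]]]; exists (e * c)%N, (e' * c)%N, (phi a), (hm_den s).
by rewrite KmapE !PoszM mulrBl; split=> //; apply: hm_deg.
Qed.

Lemma K0_map_subproof (x : K0 G) : Kmap (val x) \in @K0_pred B H.
Proof.
case: x => x /= /asboolP Kx; apply/asboolP.
by rewrite -(mul0r c%:Z); apply: Kmap_deg.
Qed.

Definition K0_map (x : K0 G) : K0 H := MkK0 (K0_map_subproof x).

Lemma K0_map_is_zmod_morphism : zmod_morphism K0_map.
Proof. by move=> x y; apply: val_inj; rewrite /= !rmorphB. Qed.
Lemma K0_map_is_monoid_morphism : monoid_morphism K0_map.
Proof. by split=> [|x y]; apply: val_inj; rewrite /= ?rmorph1 ?rmorphM. Qed.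
HB.instance Definition _ :=
  GRing.isZmodMorphism.Build (K0 G) (K0 H) K0_map K0_map_is_zmod_morphism.
HB.instance Definition _ :=
  GRing.isMonoidMorphism.Build (K0 G) (K0 H) K0_map K0_map_is_monoid_morphism.
End Kmap.

(* The ideal a of the presentation is the kernel of the surjection galg_pres. *)
Record galg (k : fieldType) (n : nat) := GAlg {
  galg_ring :> comNzRingType;
  galg_pres : {rmorphism {mpoly k[n.+1]} -> galg_ring};
  galg_surj : forall a, exists p, galg_pres p = a
}.

Section GAlg.
Variables (k : fieldType) (n : nat) (R : galg k n).
Local Notation pres := (@galg_pres k n R).

Definition homogeneous_presentation :=
  forall p : {mpoly k[n.+1]}, pres p = 0 ->
  forall e : nat, pres (pihomog mdeg e p) = 0.

Definition gen (i : 'I_n.+1) : R := pres 'X_i.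

Definition form (e : nat) (a : R) :=
  exists2 p : {mpoly k[n.+1]}, p \is e.-homog & pres p = a.

Lemma form0 e : form e 0.
Proof. by exists 0; rewrite ?rmorph0 ?dhomog0. Qed.
Lemma formB e a b : form e a -> form e b -> form e (a - b).
Proof.
by move=> [p hp <-] [q hq <-]; exists (p - q); rewrite ?rmorphB // rpredB.
Qed.
Lemma form1 : form 0 1.
Proof. by exists 1; rewrite ?rmorph1 ?dhomog1. Qed.
Lemma formM e e' a b : form e a -> form e' b -> form (e + e') (a * b).
Proof.
by move=> [p hp <-] [q hq <-]; exists (p * q); rewrite ?rmorphM // dhomogM.
Qed.

Definition std_grading : grading R := Grading form0 formB form1 formM.

Section Veronese.
Variable d : nat.

Definition veronese_pred : {pred R} := fun a =>
  `[< exists2 s : seq R, (forall c, c \in s -> exists i, form (i * d) c)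
                       & a = \sum_(c <- s) c >].

Lemma veronese_form i a : form (i * d) a -> a \in veronese_pred.
Proof.
move=> ha; apply/asboolP; exists [:: a]; last by rewrite big_seq1.
by move=> c; rewrite inE => /eqP ->; exists i.
Qed.

Lemma veronese_subring : subring_closed veronese_pred.
Proof.
split.
- by apply: (@veronese_form 0); rewrite mul0n; apply: form1.
- move=> _ _ /asboolP[s hs ->] /asboolP[t ht ->]; apply/asboolP.
  exists (s ++ map -%R t); last by rewrite big_cat big_map sumrN.
  move=> c; rewrite mem_cat => /orP[/hs //|/mapP[b /ht[i hb] ->]].
  by exists i; rewrite -sub0r; apply: formB => //; apply: form0.
- move=> _ _ /asboolP[s hs ->] /asboolP[t ht ->]; apply/asboolP.
  exists [seq a * b | a <- s, b <- t].
    move=> c /allpairsP[[a b] [/= /hs[i ha] /ht[j hb] ->]].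
    by exists (i + j)%N; rewrite mulnDl; apply: formM.
  by rewrite big_allpairs_dep big_distrlr.
Qed.
HB.instance Definition _ :=
  GRing.isSubringClosed.Build R veronese_pred veronese_subring.

Record veronese := Veronese { ver_val : R; _ : ver_val \in veronese_pred }.
HB.instance Definition _ := [isSub for ver_val].
HB.instance Definition _ := [Choice of veronese by <:].
HB.instance Definition _ := [SubChoice_isSubComNzRing of veronese by <:].

Definition ver_comp (i : nat) (a : veronese) := form (i * d) (val a).

Lemma ver_comp0 i : ver_comp i 0.
Proof. exact: form0. Qed.
Lemma ver_compB i a b : ver_comp i a -> ver_comp i b -> ver_comp i (a - b).
Proof. exact: formB. Qed.
Lemma ver_comp1 : ver_comp 0 1.
Proof. by rewrite /ver_comp mul0n; apply: form1. Qed.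
Lemma ver_compM i j a b :
  ver_comp i a -> ver_comp j b -> ver_comp (i + j) (a * b).
Proof. by rewrite /ver_comp mulnDl; apply: formM. Qed.

Definition ver_grading : grading veronese :=
  Grading ver_comp0 ver_compB ver_comp1 ver_compM.
End Veronese.

Section Subalgebra.
Variables (m : nat) (f : 'I_m.+1 -> R).

Definition aeval : {rmorphism {mpoly k[m.+1]} -> R} :=
  mmap (pres \o @mpolyC n.+1 k) f.

Definition subalg_pred : {pred R} := fun a => `[< exists p, aeval p = a >].

Lemma subalg_aeval p : aeval p \in subalg_pred.
Proof. by apply/asboolP; exists p. Qed.

Lemma subalg_subring : subring_closed subalg_pred.
Proof.
split; first by rewrite -(rmorph1 aeval) subalg_aeval.
- by move=> _ _ /asboolP[p <-] /asboolP[q <-]; rewrite -rmorphB subalg_aeval.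
- by move=> _ _ /asboolP[p <-] /asboolP[q <-]; rewrite -rmorphM subalg_aeval.
Qed.
HB.instance Definition _ :=
  GRing.isSubringClosed.Build R subalg_pred subalg_subring.

Record subalg := Subalg { sub_val : R; _ : sub_val \in subalg_pred }.
HB.instance Definition _ := [isSub for sub_val].
HB.instance Definition _ := [Choice of subalg by <:].
HB.instance Definition _ := [SubChoice_isSubComNzRing of subalg by <:].

Definition subalg_pres (p : {mpoly k[m.+1]}) : subalg := Subalg (subalg_aeval p).
Lemma subalg_pres_zmod : zmod_morphism subalg_pres.
Proof. by move=> p q; apply: val_inj; rewrite /= rmorphB. Qed.
Lemma subalg_pres_monoid : monoid_morphism subalg_pres.
Proof. by split=> [|p q]; apply: val_inj; rewrite /= ?rmorph1 ?rmorphM. Qed.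
HB.instance Definition _ :=
  GRing.isZmodMorphism.Build _ subalg subalg_pres subalg_pres_zmod.
HB.instance Definition _ :=
  GRing.isMonoidMorphism.Build _ subalg subalg_pres subalg_pres_monoid.
Lemma subalg_pres_surj (a : subalg) : exists p, subalg_pres p = a.
Proof. by case: a => a ha; have /asboolP[p pa] := ha; exists p; apply: val_inj. Qed.

(* S = k[Y_0, ..., Y_m]/b with Y_j |-> f_j; its forms of degree i are the     *)
(* g(f) with g homogeneous of degree i, so the grading is renormalized.       *)
Definition image_alg : galg k m := GAlg subalg_pres_surj.

Definition contraction (P : {pred R}) : {pred image_alg} :=
  fun s : subalg => val s \in P.
End Subalgebra.

Section Quotient.
Variable P : prime_idealr R.

Definition quotient_pres : {rmorphism {mpoly k[n.+1]} -> {ideal_quot P}} :=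
  \pi_{ideal_quot P} \o pres.

Lemma quotient_pres_surj (a : {ideal_quot P}) : exists p, quotient_pres p = a.
Proof. by have [p pE] := galg_surj (repr a); exists p; rewrite /= pE reprK. Qed.

Definition quotient_alg : galg k n := GAlg quotient_pres_surj.
End Quotient.
End GAlg.

Arguments form {k n} R e a.
Arguments gen {k n} R i.
Arguments std_grading {k n} R.
Arguments homogeneous_presentation {k n} R.
Arguments veronese {k n} R d.
Arguments ver_grading {k n} R d.
Arguments quotient_alg {k n} R P.

Section RationalMaps.
Variables (k : fieldType) (n : nat) (R : galg k n).

Definition equivalent (m : nat) (f f' : 'I_m.+1 -> R) :=
  exists F F' : R, [/\ hreg (std_grading R) F, hreg (std_grading R) F' &
    forall j, F * f' j = F' * f j].

Section Datum.
Variables (m : nat) (f : 'I_m.+1 -> R).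

(* R is torsionfree over k[f]: over a reduced Noetherian ring this says that   *)
(* regular elements of k[f] are regular in R; the lemma image_alg_reg below   *)
(* proves the direction used to form the maps on fractions.                   *)
Definition torsionfree :=
  forall P : {pred R}, minimal_prime P -> minimal_prime (contraction (f := f) P).

Record rational_datum (d : nat) : Prop := RationalDatum {
  datum_deg : (1 <= d)%N;
  datum_form : forall j, form R d (f j);
  datum_torsionfree : torsionfree;
  datum_nonzero : forall P : {pred R}, minimal_prime P ->
    ~ (forall j, f j \in P)
}.
End Datum.
End RationalMaps.

Arguments torsionfree {k n} R {m} f.
Arguments rational_datum {k n} R {m} f d.

(* sub_val (g i) is g_i(f), as S is realized as the subring k[f] of R. *)
Definition birational (k : fieldType) (n : nat) (R : galg k n) (m : nat)
    (f : 'I_m.+1 -> R) :=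
  exists (e : nat) (g : 'I_n.+1 -> image_alg f),
    rational_datum (image_alg f) g e /\
    equivalent (fun i => sub_val (g i)) (gen R).

Section InducedMaps.
Variables (k : fieldType) (n : nat) (R : galg k n) (m d : nat).
Variables (f : 'I_m.+1 -> R).
Hypotheses (redR : reduced R) (hf : rational_datum R f d).
Let S := image_alg f.

Lemma image_alg_reg (s : S) : GRing.lreg s -> GRing.lreg (sub_val s).
Proof.
move=> regs; apply: reg_of_minimal_primes => // P minP; apply/negP => sP.
apply: (minimal_prime_nonreg _ (datum_torsionfree hf minP) (s := s)) => // a e ae0.
by apply: val_inj; apply: (redR (e := e)); rewrite -rmorphXn ae0.
Qed.

Lemma aeval_form i p : p \is i.-homog -> form R (i * d) (aeval f p).
Proof.
move=> /dhomogP hp; rewrite /aeval /= /mmap big_seq.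
apply: (big_ind (form R (i * d))) => [|a b ha hb|mm /hp /= hmm].
- exact: form0.
- exact: (@gcompD R (std_grading R)).
- rewrite -[X in form R X _]add0n; apply: formM.
    by exists (p@_mm)%:MP; rewrite ?dhomogE ?msuppC //=; case: ifP => //= _; rewrite mdeg0.
  rewrite -hmm /mmap1 mdegE big_distrl /=.
  apply: (big_ind2 (form R)) => [|e a e' b|j _]; [exact: form1|exact: formM|].
  elim: (mm j) => [|e ihe]; first exact: form1.
  by rewrite exprS mulSn; apply: formM => //; apply: datum_form.
Qed.

Lemma image_alg_deg i (s : S) : form S i s -> form R (i * d) (sub_val s).
Proof. by move=> [p hp <-]; apply: aeval_form. Qed.

Definition to_source : hmorph d (std_grading S) (std_grading R) :=
  @HMorph d S (std_grading S) R (std_grading R)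
    (\val : {rmorphism subalg f -> R})
    image_alg_deg (fun s hs => image_alg_reg hs.2).

Lemma image_alg_veronese (s : S) : sub_val s \in @veronese_pred k n R d.
Proof.
case: s => s /= /asboolP[p <-].
rewrite (pihomog_partitionE (leqnn (mmeasure mdeg p))) rmorph_sum rpred_sum // => i _.
by apply: veronese_form; apply: aeval_form; apply: pihomogP.
Qed.

Definition ver_fun (s : S) : veronese R d := Veronese (image_alg_veronese s).
Lemma ver_fun_zmod : zmod_morphism ver_fun.
Proof. by move=> s t; apply: val_inj. Qed.
Lemma ver_fun_monoid : monoid_morphism ver_fun.
Proof. by split=> [|s t]; apply: val_inj. Qed.
HB.instance Definition _ :=
  GRing.isZmodMorphism.Build S (veronese R d) ver_fun ver_fun_zmod.
HB.instance Definition _ :=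
  GRing.isMonoidMorphism.Build S (veronese R d) ver_fun ver_fun_monoid.

Lemma ver_fun_deg i (s : S) :
  std_grading S i s -> ver_grading R d (i * 1)%N (ver_fun s).
Proof. by rewrite muln1; apply: image_alg_deg. Qed.

Lemma ver_fun_reg (s : S) : hreg (std_grading S) s -> GRing.lreg (ver_fun s).
Proof.
move=> [_ regs] a b ab; apply: val_inj; apply: (image_alg_reg regs).
exact: (congr1 val ab).
Qed.

Definition to_veronese : hmorph 1 (std_grading S) (ver_grading R d) :=
  HMorph (hm_fun := ver_fun) ver_fun_deg ver_fun_reg.

Definition induced_K0 : {rmorphism K0 (std_grading S) -> K0 (std_grading R)} :=
  K0_map to_source.

Definition induced_K : {rmorphism K (std_grading S) -> K (ver_grading R d)} :=
  Kmap to_veronese.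

Lemma induced_K_homogeneous j x : Kcomp j x -> Kcomp j (induced_K x).
Proof. by move=> /(Kmap_deg to_veronese); rewrite mulr1. Qed.
End InducedMaps.

Definition restrict (k : fieldType) (n : nat) (R : galg k n) (m : nat)
    (f : 'I_m.+1 -> R) (P : prime_idealr R) : 'I_m.+1 -> quotient_alg R P :=
  fun j => \pi_{ideal_quot P} (f j).

(* Main.v *)
(* A fraction a/s of forms of the same degree lies in K(S)_0 exactly when
   a t = b s for some forms b, t of k[f] of equal degree with t regular; call
   (C) the assertion that this holds for all a/s, which is (c).
   If F x_i = F' g_i(f), then F^e p(x) = F'^e p(g(f)) for p homogeneous of
   degree e, so p(x)/q(x) = p(g(f))/q(g(f)): thus (a) gives (C), and comparing
   membership in minimal primes gives (b).  Conversely R and S have regular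
   forms of all large degrees, by homogeneous prime avoidance over the finitely
   many minimal primes.  Taking them in two consecutive degrees turns the x_i
   into elements of K(R)_0, whence (C) implies (a), and turns the elements of
   R^(d) into elements of K(R)_0 up to a factor from K(S), whence (C) is
   equivalent to (d).  Under (b), for each minimal prime P the equation
   a t = b s holds modulo P with t outside P; since P is the only minimal prime
   over its contraction, it holds in R after multiplying by a form of S outside
   P, and prime avoidance in the ideal of all such t glues these solutions. *)
From HB Require Import structures.
From mathcomp Require Import all_boot all_order all_algebra generic_quotient ring_quotient.
From mathcomp Require Import mpoly ring zify boolp classical_sets.
Require Import Defs.

Set Implicit Arguments.
Unset Strict Implicit.
Unset Printing Implicit Defensive.

Import Order.TTheory GRing.Theory.
Local Open Scope ring_scope.
Local Open Scope quotient_scope.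

(** * Noetherianity and finiteness of the set of minimal primes *)

(** Each next index is chosen where [u] is least among all later indices; [u] then cannot drop along
    the chosen indices. *)
Lemma nondecreasing_subsequence (u : nat -> nat) :
  exists phi : nat -> nat, (forall i j, (i < j)%N -> (phi i < phi j)%N) /\
    (forall i j, (i <= j)%N -> (u (phi i) <= u (phi j))%N).
Proof.
have argmin N : exists i, (N <= i)%N /\ forall j, (N <= j)%N -> (u i <= u j)%N.
  have ex : exists v, `[< exists2 i, (N <= i)%N & u i = v >].
    by exists (u N); apply/asboolP; exists N.
  case: (ex_minnP ex) => v /asboolP[i Ni <-] minv; exists i; split=> // j Nj.
  by apply: minv; apply/asboolP; exists j.
have {argmin} [am amP] := choice argmin.
pose phi := fix phi i := if i is i'.+1 then am (phi i').+1 else am 0%N.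
have phiS i : (phi i < phi i.+1)%N by have [] := amP (phi i).+1.
have phi_min i j : (phi i <= j)%N -> (u (phi i) <= u j)%N.
  case: i => [|i] ij; first by have [_] := amP 0%N; apply.
  have [lt_i] := amP (phi i).+1; apply.
  exact: leq_trans lt_i ij.
have phi_lt : {homo phi : i j / (i < j)%N} by apply: homo_ltn; [exact: ltn_trans|].
exists phi; split=> // i j; rewrite leq_eqVlt => /predU1P[->//|ij].
by apply: phi_min; apply: ltnW; apply: phi_lt.
Qed.

(** The sequences are treated one at a time: passing to a further subsequence keeps the earlier ones
    nondecreasing. *)
Lemma nondecreasing_subsequences (r : nat) (u : nat -> nat -> nat) :
  exists phi : nat -> nat, (forall i j, (i < j)%N -> (phi i < phi j)%N) /\
    (forall c i j, (c < r)%N -> (i <= j)%N -> (u c (phi i) <= u c (phi j))%N).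
Proof.
elim: r => [|r [phi [phi_lt phi_le]]]; first by exists id.
have [psi [psi_lt psi_le]] := nondecreasing_subsequence (u r \o phi).
have leW (f : nat -> nat) : (forall i j, (i < j)%N -> (f i < f j)%N) ->
    forall i j, (i <= j)%N -> (f i <= f j)%N.
  by move=> lf i j; rewrite leq_eqVlt => /predU1P[->//|/lf/ltnW].
exists (phi \o psi); split=> [i j /psi_lt/phi_lt //|c i j].
rewrite ltnS leq_eqVlt => /predU1P[->|cr] ij; first exact: psi_le.
by apply: phi_le => //; apply: leW ij.
Qed.

(** Along a subsequence on which all exponents are nondecreasing, the first two terms are already
    comparable. *)
Lemma dickson n (M : nat -> 'X_{1..n}) :
  exists i j, (i < j)%N /\ (M i <= M j)%MM.
Proof.
have [phi [phi_lt phi_le]] := nondecreasing_subsequences n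
  (fun c i => nth 0%N (M i) c).
exists (phi 0%N), (phi 1%N); split; first exact: phi_lt.
by apply/mnm_lepP => c; rewrite !(mnm_nth 0%N); apply: phi_le.
Qed.

(** * Finitely generated ideals *)

Section GeneratedIdeals.
Variable A : comNzRingType.
Implicit Types (s : seq A) (J : A -> Prop).

(** Unlike [idealr_closed], this admits the unit ideal. *)
Definition ideal_like J :=
  [/\ J 0, forall x y, J x -> J y -> J (x + y) & forall c x, J x -> J (c * x)].

(** The intersection of all ideals containing [s]: no linear combinations need to be written, and
    inclusions are proved by exhibiting an ideal. *)
Definition ideal_gen s (a : A) :=
  forall J, ideal_like J -> (forall x, x \in s -> J x) -> J a.

Lemma ideal_gen_like s : ideal_like (ideal_gen s).
Proof.
split=> [J []//|x y gx gy J idJ sJ|c x gx J idJ sJ]; have [_ JD JM] := idJ.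
  by apply: JD; [apply: gx|apply: gy].
by apply: JM; apply: gx.
Qed.

Lemma mem_ideal_gen s x : x \in s -> ideal_gen s x.
Proof. by move=> sx J _; apply. Qed.

Lemma ideal_gen_rcons s a x : ideal_gen (rcons s a) x ->
  exists2 u, ideal_gen s u & exists c, x = u + c * a.
Proof.
have [g0 gD gM] := ideal_gen_like s.
move=> /(_ (fun y => exists2 u, ideal_gen s u & exists c, y = u + c * a)).
apply; first split.
- by exists 0 => //; exists 0; rewrite mul0r addr0.
- move=> _ _ [u gu [c ->]] [v gv [c' ->]]; exists (u + v); first exact: gD.
  by exists (c + c'); ring.
- move=> b _ [u gu [c ->]]; exists (b * u); first exact: gM.
  by exists (b * c); ring.
- move=> y; rewrite mem_rcons inE => /predU1P[->|sy].
    by exists 0 => //; exists 1; ring.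
  by exists y; [exact: mem_ideal_gen|exists 0; ring].
Qed.

End GeneratedIdeals.

(** * Hilbert's basis theorem by leading monomials *)

Section HilbertBasis.
Variables (k : fieldType) (n : nat).
Implicit Types (p q : {mpoly k[n]}).

(** One division step: [c] is the quotient of the leading terms. *)
Lemma mlead_reduce p q : p != 0 -> q != 0 -> (mlead p <= mlead q)%MM ->
  exists c, q - c * p = 0 \/ (mlead (q - c * p) < mlead q)%O.
Proof.
move=> p0 q0 lepq; pose c := (mleadc q / mleadc p) *: 'X_[mlead q - mlead p].
have lc0 : mleadc q / mleadc p != 0 by rewrite mulf_neq0 ?invr_eq0 ?mleadc_eq0.
have X0 : 'X_[k, (mlead q - mlead p)] != 0 by rewrite -msupp_eq0 msuppX.
have c0 : c != 0 by rewrite scaler_eq0 negb_or lc0.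
have lmc : mlead (c * p) = mlead q.
  by rewrite mleadM // mleadZ // mleadXm addmC addmBA // addmC addmK.
exists c; have [->|r0] := eqVneq (q - c * p) 0; [by left|right].
have le_q : (mlead (q - c * p) <= mlead q)%O.
  by apply: le_trans (mleadB_le _ _) _; rewrite lmc joinxx.
(* With an unchanged leading monomial, the leading coefficient of the difference would be nonzero,
   but the two leading coefficients cancel. *)
rewrite lt_neqAle le_q andbT; apply/eqP => e.
have := mleadc_eq0 (q - c * p); rewrite (negPf r0) e => /negP; apply.
rewrite mcoeffB -{2}lmc.
have -> : mleadc (c * p) = mleadc c * mleadc p.
  by rewrite mleadM // mleadcM.
rewrite mleadZ // mleadXm mcoeffZ mcoeffX eqxx mulr1 divfK ?subrr //.
by rewrite mleadc_eq0.
Qed.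

(* If no finite subset of J generates it, choose f_0, f_1, ... in J, each with
   minimal leading monomial outside the ideal of its predecessors; by Dickson's
   lemma some f_j can be reduced by an earlier f_i, against minimality. *)
Lemma mpoly_noetherian (J : {mpoly k[n]} -> Prop) : ideal_like J ->
  exists2 s, (forall x, x \in s -> J x) & forall x, J x -> ideal_gen s x.
Proof.
move=> [J0 JD JM]; apply: contrapT => nfg.
have next (s : seq {mpoly k[n]}) : exists p, (forall x, x \in s -> J x) ->
    [/\ J p, ~ ideal_gen s p & forall q, J q -> (mlead q < mlead p)%O -> ideal_gen s q].
  have [sJ|sJ] := pselect (forall x, x \in s -> J x); last by exists 0.
  have [q Jq sq] : exists2 q, J q & ~ ideal_gen s q.
    apply: contrapT => h; apply: nfg; exists s => // x Jx.
    by apply: contrapT => sx; apply: h; exists x.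
  elim/mleadrect: q Jq sq => q IHq Jq sq.
  have [[q' [Jq' lt_q' sq']]|minq] :=
    pselect (exists q', [/\ J q', (mlead q' < mlead q)%O & ~ ideal_gen s q']).
    exact: IHq Jq' sq'.
  exists q => _; split=> // q' Jq' lt_q'.
  by apply: contrapT => sq'; apply: minq; exists q'.
have {next} [nxt nxtP] := choice next.
pose gens := fix gens i := if i is i'.+1 then rcons (gens i') (nxt (gens i')) else [::].
have gensJ i x : x \in gens i -> J x.
  elim: i x => [//|i IHi] x /=; rewrite mem_rcons inE => /predU1P[->|/IHi //].
  by have [] := nxtP _ IHi.
pose f i := nxt (gens i).
have f_gens i j : (i < j)%N -> f i \in gens j.
  elim: j => // j IHj; rewrite ltnS leq_eqVlt /= mem_rcons inE.
  by move=> /predU1P[->|/IHj ->]; rewrite ?eqxx ?orbT.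
have fP i : [/\ J (f i), ~ ideal_gen (gens i) (f i) &
    forall q, J q -> (mlead q < mlead (f i))%O -> ideal_gen (gens i) q].
  exact: nxtP (@gensJ i).
have f0 i : f i != 0.
  by apply/eqP => fi0; have [_ []] := fP i; rewrite fi0; have [] := ideal_gen_like (gens i).
have [i [j [ij lead_ij]]] := dickson (fun i => mlead (f i)).
have [Jj nj minj] := fP j; have [Ji _ _] := fP i.
have [g0 gD gM] := ideal_gen_like (gens j).
have gi : ideal_gen (gens j) (f i) by apply: mem_ideal_gen; apply: f_gens.
have [c red] := mlead_reduce (f0 i) (f0 j) lead_ij.
apply: nj; rewrite -[f j](subrK (c * f i)); apply: gD; last exact: gM.
case: red => [->//|]; apply: minj; apply: JD => //.
by rewrite -mulNr; apply: JM.
Qed.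
End HilbertBasis.

(** * Finitely many primes cover the radical *)

Section FiniteMinimalPrimes.
Variables (k : fieldType) (n : nat) (R : galg k n).

(** Noetherianity as a chain condition. After lifting the sequence to polynomials, the union [J] of
    the ascending ideals is finitely generated, so it is reached at a finite stage [N]; the result
    is pushed down to [R]. *)
Lemma galg_no_bad_sequence (a : nat -> R) :
  exists i, ideal_gen [seq a j | j <- iota 0 i] (a i).
Proof.
have [p pE] := choice (fun i => @galg_surj k n R (a i)).
pose J q := exists i, ideal_gen [seq p j | j <- iota 0 i] q.
have mono i i' q : (i <= i')%N -> ideal_gen [seq p j | j <- iota 0 i] q ->
    ideal_gen [seq p j | j <- iota 0 i'] q.
  move=> ii' gq; apply: gq; first exact: ideal_gen_like.
  move=> _ /mapP[j + ->]; rewrite mem_iota => ji; apply: mem_ideal_gen.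
  by apply: map_f; rewrite mem_iota (leq_trans _ ii').
have idJ : ideal_like J.
  split; first by exists 0%N; have [] := ideal_gen_like [seq p j | j <- iota 0 0].
    move=> x y [i gx] [j gy]; exists (maxn i j).
    have [_ + _] := ideal_gen_like [seq p l | l <- iota 0 (maxn i j)].
    by apply; [apply: mono gx; apply: leq_maxl|apply: mono gy; apply: leq_maxr].
  move=> c x [i gx]; exists i.
  by have [_ _] := ideal_gen_like [seq p l | l <- iota 0 i]; apply.
have [s sJ sgen] := mpoly_noetherian idJ.
have [N sN] : exists N, forall x, x \in s -> ideal_gen [seq p j | j <- iota 0 N] x.
  elim: s sJ {sgen} => [|x s IHs] sJ; first by exists 0%N.
  have [i gx] := sJ x (mem_head _ _).
  have [y sy|N gN] := IHs; first by apply: sJ; rewrite inE sy orbT.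
  exists (maxn i N) => y; rewrite inE => /predU1P[->|/gN].
    by apply: mono gx; apply: leq_maxl.
  by apply: mono; apply: leq_maxr.
have gpN : ideal_gen [seq p j | j <- iota 0 N] (p N).
  apply: (sgen (p N)) => //; last exact: ideal_gen_like.
  by exists N.+1; apply: mem_ideal_gen; apply: map_f; rewrite mem_iota /=.
exists N; move=> I idI aI; rewrite -pE; apply: (gpN (fun q => I (galg_pres R q))).
  have [I0 ID IM] := idI; split; first by rewrite rmorph0.
    by move=> x y Ix Iy; rewrite rmorphD; apply: ID.
  by move=> c x Ix; rewrite rmorphM; apply: IM.
by move=> _ /mapP[j jN ->]; rewrite pE; apply: aI; apply: map_f.
Qed.

(** The second condition places the intersection of the primes inside the radical of the ideal
    generated by [s]. *)
Definition prime_cover (s : seq R) (Ps : seq {pred R}) :=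
  (forall P, List.In P Ps -> is_prime P) /\
  (forall x, (forall P, List.In P Ps -> x \in P) -> exists e, ideal_gen s (x ^+ e)).

(** Noetherian induction. An ideal without a cover is not prime, so it contains some [a * b] with
    neither factor inside; covers of both enlargements by [a] and by [b] would together cover it.
    Hence one enlargement has no cover either, and iterating gives a strictly ascending chain. *)
Lemma exists_prime_cover : exists Ps, prime_cover [::] Ps.
Proof.
apply: contrapT => bad0; pose bad s := ~ exists Ps, prime_cover s Ps.
have next s : exists a, bad s -> ~ ideal_gen s a /\ bad (rcons s a).
  have [bs|] := pselect (bad s); last by exists 0.
  have [g0 gD gM] := ideal_gen_like s.
  pose P : {pred R} := fun x => `[< ideal_gen s x >].
  have inP x : x \in P <-> ideal_gen s x by split=> /asboolP.
  have n1 : ~ ideal_gen s 1.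
    by move=> g1; apply: bs; exists [::]; split=> // x _; exists 0%N.
  have [prP|nprP] := pselect (prime_idealr_closed P).
    case: bs; exists [:: P]; split=> [Q [<-|//]|x xP].
      split=> //; split; first exact/inP.
        by apply/negP => /inP.
      by move=> a u v /inP gu /inP gv; apply/inP; apply: gD => //; apply: gM.
    by exists 1%N; rewrite expr1; apply/inP/xP; left.
  have [a [b [gab na nb]]] : exists a b, [/\ ideal_gen s (a * b),
      ~ ideal_gen s a & ~ ideal_gen s b].
    apply: contrapT => h; apply: nprP => u v /inP guv; apply/orP.
    apply: contrapT => uv; apply: h; exists u, v; split=> // /inP ?; apply: uv;
      by [left|right].
  have [|ba] := pselect (bad (rcons s a)); first by exists a.
  have [|bb] := pselect (bad (rcons s b)); first by exists b.
  have [Ps [prPs Psa]] := contrapT ba; have [Qs [prQs Qsb]] := contrapT bb.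
  case: bs; exists (Ps ++ Qs); split=> [Q|x xPQ].
    by move=> /List.in_app_iff[/prPs|/prQs].
  have [e gxe] : exists e, ideal_gen (rcons s a) (x ^+ e).
    by apply: Psa => Q PQ; apply: xPQ; apply/List.in_app_iff; left.
  have [e' gxe'] : exists e, ideal_gen (rcons s b) (x ^+ e).
    by apply: Qsb => Q PQ; apply: xPQ; apply/List.in_app_iff; right.
  have [u gu [c xe]] := ideal_gen_rcons gxe.
  have [v gv [c' xe']] := ideal_gen_rcons gxe'.
  (* In the product of the two powers, the only term without a factor in the ideal of [s] is a
     multiple of [a * b], which lies there too. *)
  exists (e + e')%N; rewrite exprD xe xe'.
  have -> : (u + c * a) * (v + c' * b) = (v + c' * b) * u + ((c * a) * v + (c * c') * (a * b)).
    by ring.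
  by apply: (gD); [|apply: (gD)]; apply: (gM).
have {next} [nxt nxtP] := choice next.
pose gens := fix gens i := if i is i'.+1 then rcons (gens i') (nxt (gens i')) else [::].
have gens_bad i : bad (gens i) by elim: i => [//|i /nxtP[]].
have [i] := galg_no_bad_sequence (fun i => nxt (gens i)).
have -> : [seq nxt (gens j) | j <- iota 0 i] = gens i.
  by elim: i => // i IHi; rewrite -addn1 iotaD map_cat IHi addn1 /= cats1.
by have [] := nxtP _ (gens_bad i).
Qed.

(** A cover of the zero ideal contains every minimal prime [P]: if no member [Q] were inside [P], a
    product of elements of the [Q] outside [P] would lie in every [Q], hence be nilpotent, hence
    zero. *)
Lemma finite_minimal_primes : reduced R ->
  exists Ps : seq {pred R}, forall P, minimal_prime P -> List.In P Ps.
Proof.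
move=> redR; have [Ps [prPs capPs]] := exists_prime_cover.
exists Ps => P [[[P0 P1 PM] prP] minP].
have [Q PsQ QP] : exists2 Q, List.In Q Ps & {subset Q <= P}.
  apply: contrapT => nQ.
  have [x xQ xP] : exists2 x, (forall Q, List.In Q Ps -> x \in Q) & x \notin P.
    elim: Ps prPs nQ {capPs} => [|Q Ps IHPs] prPs nQ; first by exists 1.
    have [Q' ?|[Q' ? ?]|x xPs xP] := IHPs; first by apply: prPs; right.
      by apply: nQ; exists Q' => //; right.
    have [y Qy Py] : exists2 y, y \in Q & y \notin P.
      apply: contrapT => h; apply: nQ; exists Q; first by left.
      by move=> y Qy; apply: contrapT => /negP Py; apply: h; exists y.
    exists (x * y); last by apply/negP => /prP; rewrite (negPf xP) (negPf Py).
    move=> Q' [<-|/[dup] QQ' /xPs xQ'].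
      have [[Q0 _ QM] _] : is_prime Q by apply: prPs; left.
      by rewrite -[_ * _]addr0; apply: QM.
    have [[Q0 _ QM] _] : is_prime Q' by apply: prPs; right.
    by rewrite mulrC -[_ * _]addr0; apply: QM.
  have [e xe0] := capPs _ xQ; move: xP; rewrite (redR x e) ?P0 //.
  (* The ideal generated by the empty sequence is tested against the zero ideal. *)
  apply: (xe0 (fun y => y = 0)) => //; split=> // [y z -> ->|c y ->]; ring.
suff -> : P = Q by [].
by apply: funext => x; apply/idP/idP => [|/QP //]; apply: (minP Q) => //; apply: prPs.
Qed.

End FiniteMinimalPrimes.

(** * Homogenization *)

(** An alias of [P] that remembers the proof of primality, so that a [prime_idealr] structure, and
    with it the quotient ring, can be attached. *)
Definition prime_pred (A : comNzRingType) (P : {pred A}) of is_prime P : A -> bool := P.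
HB.instance Definition _ A P (prP : @is_prime A P) :=
  isIdealr.Build A (prime_pred prP) prP.1.
HB.instance Definition _ A P (prP : @is_prime A P) :=
  isPrimeIdealrClosed.Build A (prime_pred prP) prP.2.

(** * Membership in prime ideals *)

Section PrimeIdeals.
Variables (A : comNzRingType) (P : {pred A}).
Hypothesis prP : is_prime P.

Lemma prime_ideal0 : 0 \in P. Proof. by have [[]] := prP. Qed.

Lemma prime_ideal1 : 1 \notin P. Proof. by have [[]] := prP. Qed.

Lemma prime_idealM u v : (u * v \in P) = (u \in P) || (v \in P).
Proof. exact: (prime_idealrM (prime_pred prP)). Qed.

Lemma prime_idealD u v : u \in P -> v \in P -> u + v \in P.
Proof. by move=> uP vP; rewrite -[u]mul1r; have [[_ _ PM] _] := prP; apply: (PM 1 u v). Qed.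

Lemma prime_idealDr u v : v \in P -> (u + v \in P) = (u \in P).
Proof.
move=> vP; apply/idP/idP => [uvP|uP]; last exact: prime_idealD.
have -> : u = -1 * v + (u + v) by ring.
by apply: prime_idealD => //; rewrite prime_idealM vP orbT.
Qed.

Lemma prime_ideal_sum (I : Type) (r : seq I) (Q : pred I) (F : I -> A) :
  (forall i, Q i -> F i \in P) -> \sum_(i <- r | Q i) F i \in P.
Proof.
by move=> FP; apply: (big_ind (fun x => x \in P)) => //;
  [exact: prime_ideal0|exact: prime_idealD].
Qed.

Lemma prime_idealX u e : u ^+ e \in P -> u \in P.
Proof.
elim: e => [|e IHe]; first by rewrite expr0 (negPf prime_ideal1).
by rewrite exprS prime_idealM => /orP[].
Qed.

Lemma prime_idealX_notin u e : u \notin P -> u ^+ e \notin P.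
Proof. exact/contra/prime_idealX. Qed.

(** The extension of [P] to polynomials is prime: if [e] and [e'] are the least indices of
    coefficients outside [P], then in the coefficient of index [e + e'] only their product is
    outside [P]. *)
Lemma prime_ideal_coefM (q r : {poly A}) : (forall e, (q * r)`_e \in P) ->
  (forall e, q`_e \in P) \/ (forall e, r`_e \in P).
Proof.
move=> qrP; apply: contrapT => /not_orP[/existsNP[a /negP qa] /existsNP[b /negP rb]].
case: (ex_minnP (ex_intro (fun i => q`_i \notin P) a qa)) => e qe mine.
case: (ex_minnP (ex_intro (fun i => r`_i \notin P) b rb)) => e' re mine'.
have := qrP (e + e')%N; rewrite coefM.
have lt_e : (e < (e + e').+1)%N by rewrite ltnS leq_addr.
rewrite (bigD1 (Ordinal lt_e)) //= prime_idealDr.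
  by rewrite addKn prime_idealM (negPf qe) (negPf re).
apply: prime_ideal_sum => i; rewrite -val_eqE /= neq_ltn prime_idealM => /orP[ie|ei].
  by apply/orP; left; apply: contraLR ie => /mine; rewrite -leqNgt.
apply/orP; right; apply: contraLR ei => /mine'; rewrite -leqNgt => le_e'.
by have := ltn_ord i; lia.
Qed.

End PrimeIdeals.

Lemma rmorph_mmap n (k : nzRingType) (A B : comNzRingType) (phi : {rmorphism A -> B})
    (c : k -> A) (h : 'I_n -> A) p :
  phi (mmap c h p) = mmap (phi \o c) (phi \o h) p.
Proof.
rewrite /mmap rmorph_sum; apply: eq_bigr => mm _; rewrite rmorphM /mmap1 rmorph_prod.
by congr (_ * _); apply: eq_bigr => i _; rewrite rmorphXn.
Qed.

Lemma mmap_homogM n (k : nzRingType) (A : comNzRingType) (c : k -> A) (h : 'I_n -> A) t l p :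
  p \is l.-homog -> mmap c (fun i => t * h i) p = t ^+ l * mmap c h p.
Proof.
move=> /dhomogP hp; rewrite /mmap big_distrr /=; apply: eq_big_seq => mm /hp /= <-.
rewrite [RHS]mulrCA; congr (_ * _).
rewrite /mmap1 mdegE -prodrXr -big_split /=.
by apply: eq_bigr => i _; rewrite exprMn.
Qed.

Lemma eq_mmap n (k : nzRingType) (A : comNzRingType) (c c' : k -> A) (h h' : 'I_n -> A) :
  c =1 c' -> h =1 h' -> mmap c h =1 mmap c' h'.
Proof.
move=> cE hE p; apply: eq_bigr => mm _; rewrite cE; congr (_ * _).
by apply: eq_bigr => i _; rewrite hE.
Qed.

Lemma mpolyC_homog n (k : nzRingType) (c : k) : c%:MP_[n] \is 0.-homog.
Proof. by rewrite dhomogE msuppC; case: ifP => //= _; rewrite mdeg0. Qed.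

Section Evaluation.
Variables (k : fieldType) (n : nat) (R : galg k n).
Local Notation pres := (@galg_pres k n R).

Lemma aeval_gen p : aeval (gen R) p = pres p.
Proof.
rewrite [in RHS](mpolyE p) rmorph_sum; apply: eq_bigr => mm _.
rewrite -mul_mpolyC rmorphM /=; congr (_ * _).
by rewrite mpolyXE_id rmorph_prod; apply: eq_bigr => i _; rewrite rmorphXn.
Qed.

(** Every monomial of positive degree contains a variable. *)
Lemma form_in_prime (P : {pred R}) e a : is_prime P -> form R e.+1 a ->
  (forall i, gen R i \in P) -> a \in P.
Proof.
move=> prP [p hp <-] genP; rewrite -aeval_gen.
rewrite /aeval /= /mmap big_seq; apply: prime_ideal_sum => // mm.
move/dhomogP: hp => /[apply] /= mmE; rewrite prime_idealM //; apply/orP; right.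
have [i mi] : exists i, (0 < mm i)%N.
  apply: contrapT => h; have /eqP : mdeg mm = 0%N; last by rewrite mmE.
  by rewrite mdegE big1 // => i _; case: (mm i) (fun lt0 => h (ex_intro _ i lt0)) => // c /(_ isT).
rewrite /mmap1 (bigD1 i) //= prime_idealM //; apply/orP; left.
by rewrite -(prednK mi) exprS prime_idealM // genP.
Qed.

Section Scaled.
Variables (d m : nat) (h : 'I_m.+1 -> R).

(* p |-> sum_l p_l(h) X^(l d), where p_l is the degree l part of p *)
Definition scaled_eval : {rmorphism {mpoly k[m.+1]} -> {poly R}} :=
  mmap (polyC \o (pres \o @mpolyC n.+1 k)) (fun j => 'X^d * (h j)%:P).

Lemma scaled_eval_homog l p : p \is l.-homog ->
  scaled_eval p = (aeval h p)%:P * 'X^(l * d).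
Proof.
move=> hp; rewrite /scaled_eval /= (mmap_homogM _ _ _ hp) mulrC -exprM mulnC.
by rewrite [(aeval h p)%:P](rmorph_mmap polyC).
Qed.

Lemma scaled_evalE p : scaled_eval p =
  \sum_(l < mmeasure mdeg p) (aeval h (pihomog mdeg l p))%:P * 'X^(l * d).
Proof.
rewrite {1}(pihomog_partitionE (leqnn (mmeasure mdeg p))) rmorph_sum.
by apply: eq_bigr => l _; apply: scaled_eval_homog; apply: pihomogP.
Qed.

Lemma coef_scaled_eval p l : (0 < d)%N ->
  (scaled_eval p)`_(l * d) = aeval h (pihomog mdeg l p).
Proof.
(* The bound exceeds [l], so that the part of degree [l] is one of the summands even when it is
   zero. *)
move=> d0; pose K := (maxn (mmeasure mdeg p) l.+1).
rewrite (pihomog_partitionE (leq_maxl _ l.+1 : (mmeasure mdeg p <= K)%N)).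
rewrite (raddf_sum (pihomog mdeg l)) !rmorph_sum coef_sum.
apply: eq_bigr => i _; rewrite (scaled_eval_homog (pihomogP _ _ _)) coefCM coefXn.
rewrite eqn_pmul2r //; have [->|li] := eqVneq.
  by rewrite mulr1 /= pihomog_id.
by rewrite mulr0 /= (@pihomog_ne0 _ _ _ i) ?rmorph0 // ?pihomogP // eq_sym.
Qed.

End Scaled.

Lemma aeval_homog_form m d (h : 'I_m.+1 -> R) l p : (forall j, form R d (h j)) ->
  p \is l.-homog -> form R (l * d) (aeval h p).
Proof.
move=> hd /dhomogP hp; rewrite /aeval /= /mmap big_seq.
apply: (big_ind (form R (l * d))) => [|a b ha hb|mm /hp /= hmm].
- exact: form0.
- exact: (@gcompD R (std_grading R)).
- rewrite -[X in form R X _]add0n; apply: formM.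
    by exists (p@_mm)%:MP; rewrite // mpolyC_homog.
  rewrite -hmm /mmap1 mdegE big_distrl /=.
  apply: (big_ind2 (form R)) => [|e a e' b|j _]; [exact: form1|exact: formM|].
  elim: (mm j) => [|e ihe]; first exact: form1.
  by rewrite exprS mulSn; apply: formM.
Qed.

(** * Homogeneous components as coefficients of a polynomial *)

Section Homogenization.
Hypothesis gR : homogeneous_presentation R.

(* a |-> sum_e a_e X^e *)
Definition homogenize (a : R) : {poly R} :=
  scaled_eval 1 (gen R) (sval (cid (galg_surj a))).

(** Independence of the chosen lift: two lifts differ by an element of the kernel, whose homogeneous
    parts are in the kernel again. *)
Lemma homogenize_pres p : homogenize (pres p) = scaled_eval 1 (gen R) p.
Proof.
rewrite /homogenize; case: cid => q /= qp; apply/eqP; rewrite -subr_eq0 -rmorphB.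
apply/eqP/polyP => e; rewrite -{1}[e]muln1 coef_scaled_eval // coef0 aeval_gen.
by apply: gR; rewrite rmorphB qp subrr.
Qed.

Lemma homogenize_zmod_morphism : zmod_morphism homogenize.
Proof.
move=> a b; have [p <-] := galg_surj a; have [q <-] := galg_surj b.
by rewrite -rmorphB !homogenize_pres rmorphB.
Qed.

Lemma homogenize_monoid_morphism : monoid_morphism homogenize.
Proof.
split=> [|a b]; first by rewrite -(rmorph1 pres) homogenize_pres rmorph1.
have [p <-] := galg_surj a; have [q <-] := galg_surj b.
by rewrite -rmorphM !homogenize_pres rmorphM.
Qed.

Definition homogenization : {rmorphism R -> {poly R}} :=
  HB.pack homogenize
    (GRing.isZmodMorphism.Build R {poly R} homogenize homogenize_zmod_morphism)
    (GRing.isMonoidMorphism.Build R {poly R} homogenize homogenize_monoid_morphism).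

Local Notation sigma := homogenization.

Lemma homogenization_pres p e : (sigma (pres p))`_e = pres (pihomog mdeg e p).
Proof. by rewrite /= homogenize_pres -{1}[e]muln1 coef_scaled_eval // aeval_gen. Qed.

Lemma homogenization_form e a : form R e a -> sigma a = a%:P * 'X^e.
Proof.
move=> [p hp <-]; rewrite /= homogenize_pres (scaled_eval_homog _ _ hp) muln1.
by rewrite aeval_gen.
Qed.

Lemma coef_homogenization a e : form R e (sigma a)`_e.
Proof.
have [p <-] := galg_surj a; rewrite homogenization_pres.
by exists (pihomog mdeg e p); rewrite // pihomogP.
Qed.

Lemma sum_homogenization a : \sum_(e < size (sigma a)) (sigma a)`_e = a.
Proof.
(* Setting the variable to 1 undoes the homogenization. *)
have -> : \sum_(e < size (sigma a)) (sigma a)`_e = (sigma a).[1].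
  by rewrite horner_coef; apply: eq_bigr => e _; rewrite expr1n mulr1.
have [p <-] := galg_surj a; rewrite /= homogenize_pres scaled_evalE.
rewrite [in RHS](pihomog_partitionE (leqnn (mmeasure mdeg p))) rmorph_sum /= horner_sum.
by apply: eq_bigr => l _; rewrite hornerM hornerC hornerXn expr1n mulr1 aeval_gen.
Qed.

Lemma homogenization_aeval m d (h : 'I_m.+1 -> R) p : (forall j, form R d (h j)) ->
  sigma (aeval h p) = scaled_eval d h p.
Proof.
move=> hd; rewrite (rmorph_mmap sigma); apply: eq_mmap => [c|j] /=.
  rewrite [homogenize _](@homogenization_form 0) ?mulr1 //.
  by exists c%:MP; rewrite // mpolyC_homog.
by rewrite [homogenize _](homogenization_form (hd j)) mulrC.
Qed.

Lemma homogenization_aeval_coef m d (h : 'I_m.+1 -> R) p l :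
  (0 < d)%N -> (forall j, form R d (h j)) ->
  (sigma (aeval h p))`_(l * d) = aeval h (pihomog mdeg l p).
Proof. by move=> d0 hd; rewrite (homogenization_aeval p hd) coef_scaled_eval. Qed.

(** For a relation [p] among the [h j], the values at [h] of the homogeneous parts of [p] are
    coefficients of the homogenization of 0. This makes the results on graded algebras available for
    [S]. *)
Lemma image_alg_graded m d (h : 'I_m.+1 -> R) :
  (0 < d)%N -> (forall j, form R d (h j)) -> homogeneous_presentation (image_alg h).
Proof.
move=> d0 hd p /(congr1 val) /= p0 e; apply: val_inj => /=.
by rewrite -(homogenization_aeval_coef p e d0 hd) [aeval h p]p0 rmorph0 coef0.
Qed.

(** The elements with all components in [P] form a prime ideal [Q], by [prime_ideal_coefM], and it
    lies inside [P]; minimality gives equality. *)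
Lemma minimal_prime_homogeneous (P : {pred R}) a e :
  minimal_prime P -> a \in P -> (sigma a)`_e \in P.
Proof.
move=> [prP minP] aP.
pose Q : {pred R} := fun b => `[< forall i, (sigma b)`_i \in P >].
have inQ b : b \in Q <-> forall i, (sigma b)`_i \in P by split=> /asboolP.
suff /inQ : a \in Q by apply.
apply: (minP Q) => //; last first.
  by move=> b /inQ bP; rewrite -(sum_homogenization b); apply: prime_ideal_sum.
split; first split.
- by apply/inQ => i; rewrite rmorph0 coef0 prime_ideal0.
- apply/negP => /inQ/(_ 0%N).
  by rewrite rmorph1 coef1 eqxx (negPf (prime_ideal1 prP)).
- move=> b u v /inQ uP /inQ vP; apply/inQ => i; rewrite rmorphD rmorphM coefD.
  apply: prime_idealD => //; rewrite coefM; apply: prime_ideal_sum => // j _.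
  by rewrite prime_idealM // uP orbT.
- move=> u v /inQ uv; apply/orP; rewrite rmorphM in uv.
  by have [?|?] := prime_ideal_coefM prP uv; [left|right]; apply/inQ.
Qed.

End Homogenization.
End Evaluation.

(** * Homogeneous prime avoidance *)

Section MinimalPrimes.
Variable A : comNzRingType.
Implicit Types (P Q : {pred A}).

(** In a reduced ring [u * z ^+ e.+1 = 0] forces [u * z = 0], so adjoining the powers of [z] to [M]
    still avoids zero. *)
Lemma exists_minimal_prime_avoiding (M : A -> Prop) z : reduced A ->
    M 1 -> (forall u v, M u -> M v -> M (u * v)) ->
    (forall u, M u -> u * z <> 0) ->
  exists2 P, minimal_prime P & (forall u, M u -> u \notin P) /\ z \notin P.
Proof.
move=> redA M1 MM Mz.
pose M' := [set x | exists2 u, M u & exists e, x = u * z ^+ e]%classic.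
have [||P minP PM'] := @exists_minimal_prime _ M'; rewrite //.
  split; first by exists 1 => //; exists 0%N; rewrite expr0 mulr1.
  - move=> _ _ [u Mu [e ->]] [v Mv [e' ->]]; exists (u * v); first exact: MM.
    by exists (e + e')%N; rewrite exprD mulrACA.
  - case=> u Mu [[|e]] /esym.
      by rewrite expr0 mulr1 => u0; apply: (Mz u); rewrite // u0 mul0r.
    by move=> /(reduced_mulX redA); apply: Mz.
exists P => //; split=> [u Mu|]; apply: PM'.
  by exists u => //; exists 0%N; rewrite expr0 mulr1.
by exists 1 => //; exists 1%N; rewrite mul1r expr1.
Qed.

(** The localization of a reduced ring at a minimal prime is a field. Without such [u], some prime
    would avoid both [z] and the complement of [P], hence be strictly smaller than [P]. *)
Lemma minimal_prime_ann P z : reduced A -> minimal_prime P -> z \in P ->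
  exists2 u, u \notin P & u * z = 0.
Proof.
move=> redA [prP minP] zP; apply: contrapT => noann.
have [|u v uP vP|u uP uz0|Q [prQ _] [QP zQ]] :=
  @exists_minimal_prime_avoiding (fun u => u \notin P) z redA.
- exact: prime_ideal1.
- by rewrite prime_idealM // negb_or uP vP.
- by apply: noann; exists u.
have /(minP Q prQ)/(_ z zP) : {subset Q <= P}.
  by move=> x; apply: contraLR => /QP.
by rewrite (negPf zQ).
Qed.

Lemma minimal_prime_of_ann P : is_prime P ->
  (forall z, z \in P -> exists2 u, u \notin P & u * z = 0) -> minimal_prime P.
Proof.
move=> prP annP; split=> // Q prQ QP z /annP[u uP uz0].
have : u * z \in Q by rewrite uz0 prime_ideal0.
by rewrite prime_idealM // => /orP[/QP|//]; rewrite (negPf uP).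
Qed.

Lemma reg_notin_minimal_prime P s : reduced A -> minimal_prime P ->
  GRing.lreg s -> s \notin P.
Proof. by move=> redA minP regs; apply/negP => /(minimal_prime_nonreg redA minP). Qed.

Lemma lreg_factor (s t : A) : GRing.lreg (s * t) -> GRing.lreg t.
Proof. by move=> reg u v uv; apply: reg; rewrite -!mulrA uv. Qed.

Section Domain.
Hypothesis domA : forall x y : A, x * y = 0 -> (x == 0) || (y == 0).

Lemma domain_lreg (s : A) : s != 0 -> GRing.lreg s.
Proof.
move=> s0 x y /eqP; rewrite -subr_eq0 -mulrBr => /eqP/domA.
by rewrite (negPf s0) subr_eq0 => /eqP.
Qed.

Lemma domain_minimal_prime0 P : minimal_prime P -> P =i pred1 0.
Proof.
move=> [prP minP] x; apply/idP/idP => [|/eqP ->]; last exact: prime_ideal0.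
apply: (minP (pred1 0)); last by move=> y /eqP ->; apply: prime_ideal0.
split; first split; rewrite ?inE ?oner_eq0 //.
  by move=> a u v /eqP -> /eqP ->; rewrite mulr0 addr0 inE.
by move=> u v; rewrite !inE => /eqP/domA.
Qed.

Lemma domain_pred0_minimal_prime P : P =i pred1 0 -> minimal_prime P.
Proof.
move=> P0; have prP : is_prime P.
  split; first split; rewrite ?P0 ?inE ?oner_eq0 //.
    by move=> a u v; rewrite !P0 !inE => /eqP -> /eqP ->; rewrite mulr0 addr0.
  by move=> u v; rewrite !P0 !inE => /eqP/domA.
apply: minimal_prime_of_ann => // z; rewrite P0 => /eqP ->; exists 1; last by rewrite mulr0.
exact: prime_ideal1.
Qed.
End Domain.

End MinimalPrimes.

Section Preimages.
Variables (A B : comNzRingType) (phi : {rmorphism A -> B}).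

Lemma prime_preimage (P : {pred B}) : is_prime P -> is_prime [pred a | phi a \in P].
Proof.
move=> prP; split; first split; rewrite ?inE ?rmorph0 ?rmorph1 ?prime_ideal0 ?prime_ideal1 //.
  move=> a u v; rewrite !inE rmorphD rmorphM => uP vP.
  by apply: prime_idealD; rewrite // prime_idealM // uP orbT.
by move=> u v; rewrite !inE rmorphM prime_idealM.
Qed.

(** By injectivity the image of the complement of [Q] avoids zero; a minimal prime disjoint from it
    contracts into [Q], hence onto [Q] by minimality. *)
Lemma minimal_prime_lift (Q : {pred A}) : injective phi -> reduced B ->
  minimal_prime Q ->
  exists2 P : {pred B}, minimal_prime P & forall a, (phi a \in P) = (a \in Q).
Proof.
move=> injphi redB [prQ minQ].
have [|P minP PM] := @exists_minimal_prime _ (phi @` [set a | a \notin Q])%classic redB.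
  split; first by exists 1; rewrite ?rmorph1 //; apply: prime_ideal1.
  - move=> _ _ [u uQ <-] [v vQ <-]; exists (u * v); last by rewrite rmorphM.
    by rewrite /= prime_idealM // negb_or uQ vQ.
  - by case=> u uQ /eqP; rewrite -(rmorph0 phi) => /eqP/injphi u0; move: uQ; rewrite /= u0 prime_ideal0.
have sub : {subset [pred a | phi a \in P] <= Q}.
  by move=> a; rewrite inE; apply: contraLR => aQ; apply: PM; exists a.
exists P => // a; apply/idP/idP => [aP|]; first exact: sub.
by apply: (minQ [pred a | phi a \in P]) => //; apply: prime_preimage; case: minP.
Qed.

End Preimages.

Section Forms.
Variables (k : fieldType) (n : nat) (R : galg k n).

Lemma form_gen i : form R 1 (gen R i).
Proof. by exists 'X_i => //; rewrite dhomogX /= mdeg1. Qed.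

Lemma formX e a j : form R e a -> form R (j * e) (a ^+ j).
Proof.
move=> ea; elim: j => [|j IHj]; first exact: form1.
by rewrite exprS mulSn; apply: formM.
Qed.

End Forms.

(** * Forms outside all minimal primes *)

Section PrimeAvoidance.
Variables (k : fieldType) (n : nat) (R : galg k n).
Hypotheses (gR : homogeneous_presentation R) (redR : reduced R).
Local Notation sigma := (homogenization gR).

Lemma form_notin (P : {pred R}) a : is_prime P -> a \notin P ->
  exists e, (sigma a)`_e \notin P.
Proof.
move=> prP; apply: contraNP => /forallNP h; rewrite -(sum_homogenization gR a).
by apply: prime_ideal_sum => // e _; apply: contrapT => /negP /h.
Qed.

(** A product over the minimal primes [Q] in the list: each contributes a component, outside [P], of
    some element of [Q], and this component stays in [Q] because [Q] is homogeneous. *)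
Lemma form_separating (P : {pred R}) (Ps : seq {pred R}) : minimal_prime P ->
    ~ List.In P Ps -> exists e w, [/\ form R e w, w \notin P &
  forall Q, List.In Q Ps -> minimal_prime Q -> w \in Q].
Proof.
move=> [prP minP]; elim: Ps => [|Q Ps IHPs] nPs.
  by exists 0%N, 1; split; rewrite ?prime_ideal1 //; apply: form1.
have [|e [w [ew wP wPs]]] := IHPs; first by move=> ?; apply: nPs; right.
have [minQ|nminQ] := pselect (minimal_prime Q); last first.
  by exists e, w; split=> // Q' [<-//|]; apply: wPs.
have [y yQ yP] : exists2 y, y \in Q & y \notin P.
  apply: contrapT => h; apply: nPs; left.
  have QP : {subset Q <= P}.
    by move=> y yQ; apply: contrapT => /negP yP; apply: h; exists y.
  by apply: funext => y; apply/idP/idP => [/QP //|]; apply: (minP Q) => //; case: minQ.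
have [e' ye'] := form_notin prP yP.
exists (e + e')%N, (w * (sigma y)`_e'); split.
- by apply: formM => //; apply: coef_homogenization.
- by rewrite prime_idealM // negb_or wP.
- move=> Q' QQ' minQ'; have [prQ' _] := minQ'; rewrite prime_idealM //.
  case: QQ' => [QQ'|PsQ'].
    by rewrite minimal_prime_homogeneous ?orbT // -QQ'.
  by rewrite wPs.
Qed.

Hypothesis irrelevant : forall P, minimal_prime P -> exists i, gen R i \notin P.

(** Induction on a list containing all minimal primes. A form that falls into the new prime [P] is
    corrected by a form of [I] lying in the earlier primes but not in [P]; powers of a variable
    outside [P] bring it to the degree [N]. *)
Lemma homogeneous_prime_avoidance (I : R -> Prop) : ideal_like I ->
    (forall P, minimal_prime P -> exists e t, [/\ form R e t, I t & t \notin P]) ->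
  exists N0, forall N, (N0 <= N)%N ->
  exists t, [/\ form R N t, I t & forall P, minimal_prime P -> t \notin P].
Proof.
move=> [I0 ID IM] locI; have [Ps minPs] := finite_minimal_primes redR.
suff [N0 N0P] : exists N0, forall N, (N0 <= N)%N -> exists t, [/\ form R N t, I t &
    forall P, List.In P Ps -> minimal_prime P -> t \notin P].
  exists N0 => N /N0P[t [Nt It tPs]]; exists t; split=> // P minP.
  by apply: tPs => //; apply: minPs.
elim: Ps {minPs} => [|P Ps [N0 IHPs]].
  (* With nothing to avoid, the zero form will do in every degree. *)
  by exists 0%N => N _; exists 0; split=> //; apply: form0.
have [minP|nminP] := pselect (minimal_prime P); last first.
  exists N0 => N /IHPs[t [Nt It tPs]]; exists t; split=> // Q [<-//|]; exact: tPs.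
have [PsP|nPsP] := pselect (List.In P Ps).
  exists N0 => N /IHPs[t [Nt It tPs]]; exists t; split=> // Q [<-|]; exact: tPs.
have [prP _] := minP.
have [e1 [t1 [et1 It1 t1P]]] := locI _ minP.
have [e2 [w [e2w wP wPs]]] := form_separating minP nPsP.
have [i iP] := irrelevant minP.
exists (maxn N0 (e1 + e2)) => N; rewrite geq_max => /andP[/IHPs[t [Nt It tPs]] leN].
have [tP|tP] := boolP (t \in P); last first.
  by exists t; split=> // Q [<-//|]; apply: tPs.
pose z := w * gen R i ^+ (N - (e1 + e2)) * t1.
have zP : z \notin P.
  by rewrite !prime_idealM // !negb_or t1P wP prime_idealX_notin.
exists (t + z); split.
- apply: (@gcompD _ (std_grading R)) => //.
  have -> : N = (e2 + (N - (e1 + e2)) + e1)%N by lia.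
  apply: formM => //; apply: formM => //.
  by rewrite -[X in form R X](muln1); apply: formX; apply: form_gen.
- by apply: ID => //; apply: IM.
- move=> Q [<-|PsQ] minQ; have [prQ _] := minQ.
    by rewrite addrC prime_idealDr.
  by rewrite prime_idealDr ?tPs // !prime_idealM // wPs.
Qed.

Lemma exists_regular_forms :
  exists N0, forall N, (N0 <= N)%N -> exists2 s, form R N s & GRing.lreg s.
Proof.
have [//|P [prP _]|N0 N0P] := @homogeneous_prime_avoidance (fun=> True).
  by exists 0%N, 1; split; [apply: form1| |apply: prime_ideal1].
exists N0 => N /N0P[s [Ns _ sP]]; exists s => //.
exact: reg_of_minimal_primes.
Qed.

End PrimeAvoidance.

(** * Lifting degree-zero fractions to the image *)

Section Fractions.
Variables (k : fieldType) (n : nat) (R : galg k n).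

Lemma aeval_proportional m (x y : 'I_m.+1 -> R) F F' e p : p \is e.-homog ->
  (forall j, F * x j = F' * y j) -> F ^+ e * aeval x p = F' ^+ e * aeval y p.
Proof.
move=> hp xy; rewrite /aeval /= -!(mmap_homogM _ _ _ hp).
exact: eq_mmap.
Qed.

Lemma sub_val_aeval m (f : 'I_m.+1 -> R) r (g : 'I_r.+1 -> image_alg f) p :
  sub_val (aeval g p) = aeval (fun i => sub_val (g i)) p.
Proof.
rewrite [LHS](rmorph_mmap (\val : {rmorphism subalg f -> R})).
by apply: eq_mmap => [c|//]; rewrite /= mmapC.
Qed.

(** Assertion (C), with denominators cleared so that no ring of fractions appears. *)
Definition fractions_lift m (f : 'I_m.+1 -> R) :=
  forall e a s, form R e a -> form R e s -> GRing.lreg s ->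
  exists N (b t : image_alg f), [/\ form (image_alg f) N b, form (image_alg f) N t,
    GRing.lreg (sub_val t) & a * sub_val t = sub_val b * s].

Lemma birational_fractions_lift m (f : 'I_m.+1 -> R) :
  birational f -> fractions_lift f.
Proof.
move=> [e0 [g [[_ ge0 _ _] [F [F' [[_ regF] [_ regF'] FE]]]]]] e _ _ [p hp <-] [q hq <-].
rewrite -!aeval_gen => regs; exists (e * e0)%N, (aeval g p), (aeval g q).
have Ep := aeval_proportional hp FE; have Eq := aeval_proportional hq FE.
rewrite !sub_val_aeval; split; try exact: aeval_homog_form.
  (* The denominator q(g(f)) divides [F ^+ e] times q(x), a product of regular elements. *)
  by apply: (@lreg_factor _ (F' ^+ e)); rewrite -Eq; apply: lregM => //; apply: lregX.
have reg : GRing.lreg (F ^+ e * F' ^+ e) by apply: lregM; apply: lregX.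
apply: reg => /=.
set a := aeval _ p in Ep *; set s := aeval _ q in Eq *.
set b := aeval _ p in Ep *; set t := aeval _ q in Eq *.
transitivity ((F ^+ e * a) * (F' ^+ e * t)); first by ring.
by rewrite Ep -Eq; ring.
Qed.

End Fractions.

(** * From fractions to birational maps *)

Lemma inj_surj_bijective (T U : Type) (h : T -> U) :
  injective h -> (forall y, exists x, h x = y) -> bijective h.
Proof.
move=> injh surjh; have [h' h'K] := choice surjh.
by exists h' => // x; apply: injh; rewrite h'K.
Qed.

Lemma Kmap_inj c A B (G : grading A) (H : grading B) (phi : hmorph c G H) :
  injective phi -> injective (Kmap phi).
Proof.
move=> injphi x y; have [a [s ->]] := HFrac.fracP x; have [b [t ->]] := HFrac.fracP y.
by rewrite !KmapE => /HFrac.fracE /=; rewrite -!rmorphM => /injphi ?; apply/HFrac.fracE.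
Qed.

Section ImageAlgebra.
Variables (k : fieldType) (n : nat) (R : galg k n) (m : nat) (f : 'I_m.+1 -> R).
Local Notation S := (image_alg f).

Definition image_alg_val : {rmorphism S -> R} := (\val : {rmorphism subalg f -> R}).

Lemma image_alg_val_inj : injective image_alg_val.
Proof. exact: val_inj. Qed.

Lemma image_alg_valE (a : S) : image_alg_val a = sub_val a. Proof. by []. Qed.

Lemma sub_valM (a b : S) : sub_val (a * b) = sub_val a * sub_val b.
Proof. by []. Qed.

(** Every component of the image is dominated by a component of the source. *)
Lemma minimal_prime_image_lift (Q : {pred S}) : reduced R -> minimal_prime Q ->
  exists2 P : {pred R}, minimal_prime P & forall a : S, (sub_val a \in P) = (a \in Q).
Proof. exact: minimal_prime_lift image_alg_val_inj. Qed.

Lemma sub_val_gen j : sub_val (gen S j) = f j.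
Proof. by rewrite /gen /= mmapX mmap1U. Qed.

Lemma image_alg_lreg (t : S) : GRing.lreg (sub_val t) -> GRing.lreg t.
Proof.
by move=> regt u v /(congr1 image_alg_val); rewrite !rmorphM => /regt/image_alg_val_inj.
Qed.

Lemma image_alg_reduced : reduced R -> reduced S.
Proof.
move=> redR a e /(congr1 image_alg_val); rewrite rmorphXn rmorph0 => /redR.
by rewrite -(rmorph0 image_alg_val) => /image_alg_val_inj.
Qed.

Lemma image_alg_domain : (forall x y : R, x * y = 0 -> (x == 0) || (y == 0)) ->
  forall x y : S, x * y = 0 -> (x == 0) || (y == 0).
Proof.
move=> domR x y /(congr1 image_alg_val); rewrite rmorphM rmorph0 => /domR.
by rewrite -{1 2}(rmorph0 image_alg_val) !(inj_eq image_alg_val_inj).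
Qed.

End ImageAlgebra.

Section Datum.
Variables (k : fieldType) (n m d : nat) (R : galg k n).
Hypotheses (gR : homogeneous_presentation R) (redR : reduced R).
Variable f : 'I_m.+1 -> R.
Hypothesis hf : rational_datum R f d.
Local Notation S := (image_alg f).

Let d0 : (0 < d)%N := datum_deg hf.
Let fd : forall j, form R d (f j) := datum_form hf.
Let gS : homogeneous_presentation S := image_alg_graded gR d0 fd.
Let redS : reduced S := image_alg_reduced redR.

Lemma source_irrelevant (P : {pred R}) : minimal_prime P -> exists i, gen R i \notin P.
Proof.
move=> minP; apply: contrapT => /forallNP h; apply: (datum_nonzero hf minP) => j.
have := fd j; rewrite -(prednK d0) => /form_in_prime; apply; first by case: minP.
by move=> i; apply: contrapT => /negP/h.
Qed.

Lemma image_irrelevant (Q : {pred S}) : minimal_prime Q -> exists j, gen S j \notin Q.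
Proof.
move=> minQ; have [P minP PQ] := minimal_prime_image_lift redR minQ.
apply: contrapT => /forallNP h; apply: (datum_nonzero hf minP) => j.
by rewrite -sub_val_gen PQ; apply: contrapT => /negP/h.
Qed.

(** Since the other factors are homogeneous, comparing components of degree [N * d + e] replaces [b]
    by its part of degree [N]. *)
Lemma fraction_component e N a s (b t : S) : form R e a -> form R e s ->
    form S N t -> a * sub_val t = sub_val b * s ->
  exists2 b' : S, form S N b' & a * sub_val t = sub_val b' * s.
Proof.
move=> ea es Nt; have [p <-] := galg_surj b => E.
exists (galg_pres S (pihomog mdeg N p)); first by exists (pihomog mdeg N p); rewrite ?pihomogP.
have Ndt : form R (N * d) (sub_val t) := image_alg_deg hf Nt.
move/(congr1 (fun x => (homogenization gR x)`_(N * d + e))): (E).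
rewrite !rmorphM (homogenization_form gR ea) (homogenization_form gR es).
rewrite (homogenization_form gR Ndt) mulrACA -polyCM -exprD coefCM coefXn [(e + _)%N]addnC eqxx mulr1 => ->.
rewrite mulrA coefMXn ltnNge leq_addl /= addnK coefMC; congr (_ * _).
exact: homogenization_aeval_coef.
Qed.

(** * Candidates for the inverse map *)

Section BirationalIntro.
Variables (e : nat) (g : 'I_n.+1 -> S) (F F' : R).
Hypotheses (e0 : (0 < e)%N) (ge : forall i, form S e (g i)).
Hypotheses (hF : hreg (std_grading R) F) (hF' : hreg (std_grading R) F').
Hypothesis FE : forall i, F * gen R i = F' * sub_val (g i).

Lemma pres_aeval_proportional l p : p \is l.-homog ->
  F ^+ l * galg_pres R p = F' ^+ l * sub_val (aeval g p).
Proof. by move=> hp; rewrite sub_val_aeval -aeval_gen; apply: aeval_proportional. Qed.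

(** Sending each generator of [R] to [g i] respects the relations: they hold degree by degree, and
    the powers of [F'] cancel. *)
Lemma pres_eq0_aeval p : galg_pres R p = 0 -> aeval g p = 0.
Proof.
move=> p0; rewrite (pihomog_partitionE (leqnn (mmeasure mdeg p))) rmorph_sum big1 // => l _.
have regFl : GRing.lreg (F' ^+ l) by apply: lregX hF'.2.
apply: (@image_alg_val_inj _ _ _ _ f); apply: regFl.
by rewrite rmorph0 mulr0 image_alg_valE -(pres_aeval_proportional (pihomogP _ _ _)) gR // mulr0.
Qed.

(** The components of p(g) stay in the homogeneous prime [Q]; the proportionality moves them to [P],
    where the powers of the regular [F] can be cancelled. *)
Lemma aeval_in_prime (P : {pred R}) (Q : {pred S}) p :
    minimal_prime P -> minimal_prime Q -> (forall a : S, (sub_val a \in P) = (a \in Q)) ->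
  aeval g p \in Q -> galg_pres R p \in P.
Proof.
move=> minP minQ PQ pQ; have [prP _] := minP.
rewrite (pihomog_partitionE (leqnn (mmeasure mdeg p))) rmorph_sum.
apply: prime_ideal_sum => // l _.
have : F ^+ l * galg_pres R (pihomog mdeg l p) \in P.
  rewrite (pres_aeval_proportional (pihomogP _ _ _)) prime_idealM //; apply/orP; right.
  rewrite PQ -(homogenization_aeval_coef gS p l e0 ge).
  exact: minimal_prime_homogeneous.
rewrite prime_idealM // (negPf (prime_idealX_notin _ _ _)) //.
exact: reg_notin_minimal_prime hF.2.
Qed.

Lemma birational_intro : birational f.
Proof.
exists e, g; split; last by exists F, F'.
split=> // [Q minQ|Q minQ gQ];
  have [P minP PQ] := minimal_prime_image_lift redR minQ.
(* For torsionfreeness, an annihilator q(x) outside [P] of p(x) is transported to an annihilator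
   q(g) outside [Q] of p(g). *)
- apply: minimal_prime_of_ann => [|z zQ].
    exact: (prime_preimage (image_alg_val g) (proj1 minQ)).
  have [p pz] := galg_surj z.
  have {}zQ : aeval g p \in Q by move: zQ; rewrite -pz.
  have [u uP uz0] := minimal_prime_ann redR minP (aeval_in_prime minP minQ PQ zQ).
  have [q qu] := galg_surj u; exists (galg_pres (image_alg g) q).
    apply/negP => qQ; have := aeval_in_prime minP minQ PQ (qQ : aeval g q \in Q).
    by rewrite qu (negPf uP).
  rewrite -pz -rmorphM; apply: (@image_alg_val_inj _ _ _ _ g); rewrite rmorph0.
  by apply: pres_eq0_aeval; rewrite rmorphM qu.
- have [i /negP] := source_irrelevant minP; apply.
  have [prP _] := minP.
  have : F * gen R i \in P by rewrite FE prime_idealM // PQ gQ orbT.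
  by rewrite prime_idealM // (negPf (reg_notin_minimal_prime redR minP hF.2)).
Qed.

End BirationalIntro.

(** The regular forms [h] and [h'] have consecutive degrees, so [gen R i * h] over [h'] has degree
    zero and equals [b i] over [t i]. The [g i] are the numerators over the common denominator
    [T]. *)
Lemma fractions_lift_birational : fractions_lift f -> birational f.
Proof.
move=> lift; have [N0 regR] := exists_regular_forms gR redR source_irrelevant.
have [M0 regS] := exists_regular_forms gS redS image_irrelevant.
have [h Nh regh] := regR _ (leqnn N0); have [h' Nh' regh'] := regR _ (leqnSn N0).
(* The factor [r] makes the degree of the [g i] positive, even when all [N i] are 0. *)
have [r Mr regr] := regS _ (leqnSn M0).
have /choice[N /choice[b /choice[t btP]]] i : exists N (b t : S), [/\ form S N b, form S N t,
    GRing.lreg (sub_val t) & gen R i * h * sub_val t = sub_val b * h'].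
  by apply: (lift N0.+1) => //; rewrite -add1n; apply: formM => //; apply: form_gen.
pose T := \prod_i t i; pose g i := b i * (\prod_(j | j != i) t j) * r.
have ET : form S (\sum_i N i) T.
  by apply: (big_ind2 (form S)) => [|? ? ? ?|i _]; [exact: form1|exact: formM|case: (btP i)].
have regT : GRing.lreg (image_alg_val f T).
  rewrite rmorph_prod; elim/big_ind: _ => [|? ?|i _]; [exact: lreg1|exact: lregM|].
  by case: (btP i).
have regr' : GRing.lreg (sub_val r) := image_alg_reg redR hf regr.
apply: (@birational_intro (\sum_i N i + M0.+1) g (h * (sub_val T * sub_val r)) h').
- by rewrite addnS.
- move=> i; apply: formM => //; rewrite (bigD1 i) //=; apply: formM; first by case: (btP i).
  by apply: (big_ind2 (form S)) => [|? ? ? ?|j _]; [exact: form1|exact: formM|case: (btP j)].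
- split; last by apply: lregM => //; apply: lregM.
  exists (N0 + ((\sum_i N i) * d + M0.+1 * d))%N.
  by apply: formM => //; apply: formM; apply: (image_alg_deg hf).
- by split=> //; exists N0.+1.
- move=> i; have [_ _ _ E] := btP i.
  rewrite /T (bigD1 i) // /g !sub_valM.
  set c := sub_val (\prod_(j | _) _).
  transitivity (gen R i * h * sub_val (t i) * c * sub_val r); first by ring.
  by rewrite E; ring.
Qed.

End Datum.

(** * Isomorphisms of rings of fractions *)

Section InducedIsomorphisms.
Variables (k : fieldType) (n m d : nat) (R : galg k n).
Hypotheses (gR : homogeneous_presentation R) (redR : reduced R).
Variable f : 'I_m.+1 -> R.
Hypothesis hf : rational_datum R f d.
Local Notation S := (image_alg f).

Let d0 : (0 < d)%N := datum_deg hf.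
Let fd : forall j, form R d (f j) := datum_form hf.
Let gS : homogeneous_presentation S := image_alg_graded gR d0 fd.
Let redS : reduced S := image_alg_reduced redR.

Lemma fractions_lift_K0 : fractions_lift f -> bijective (induced_K0 redR hf).
Proof.
move=> lift; apply: inj_surj_bijective => [x y /(congr1 val) /= xy|[y hy]].
  by apply: val_inj; apply: (Kmap_inj (phi := to_source redR hf)) xy; apply: val_inj.
have /K0P[e [a [s [ea es yE]]]] := hy.
have [N [b [t [Nb Nt regt E]]]] := lift e a _ ea es (@HFrac.den_reg _ _ s).
have ht : hreg (std_grading S) t by split; [exists N|apply: image_alg_lreg].
have bt : hfrac b (HFrac.mkden ht) \in @K0_pred S (std_grading S).
  by apply/K0P; exists N, b, (HFrac.mkden ht).
exists (MkK0 bt); apply: val_inj; rewrite /= yE KmapE; apply/HFrac.fracE => /=.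
by rewrite E.
Qed.

Lemma K0_fractions_lift : bijective (induced_K0 redR hf) -> fractions_lift f.
Proof.
move=> [inv _ invK] e a s ea es regs.
have hs : hreg (std_grading R) s by split=> //; exists e.
have as_K0 : hfrac a (HFrac.mkden hs) \in @K0_pred R (std_grading R).
  by apply/K0P; exists e, a, (HFrac.mkden hs).
have /(congr1 val) /= := invK (MkK0 as_K0).
case: (inv _) => x hx /=; have /K0P[N [b [t [Nb Nt ->]]]] := hx.
rewrite KmapE => /HFrac.fracE /= E; exists N, b, (den_val t); split=> //.
by apply: (image_alg_reg redR hf); apply: HFrac.den_reg.
Qed.

(** If [s] kills a component [c] of an element of [R], it kills [c ^+ d], which lies in the Veronese
    subring; so [c ^+ d = 0], and [c = 0] as [R] is reduced. *)
Lemma veronese_reg (s : veronese R d) i :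
  form R i (ver_val s) -> GRing.lreg s -> GRing.lreg (ver_val s).
Proof.
move=> is_ regs.
suff ann0 a : ver_val s * a = 0 -> a = 0.
  by move=> a b /eqP; rewrite -subr_eq0 -mulrBr => /eqP/ann0/eqP; rewrite subr_eq0 => /eqP.
move=> sa0; rewrite -(sum_homogenization gR a) big1 // => e _.
set c := (homogenization gR a)`_e.
have ec : form R e c by apply: coef_homogenization.
have sc0 : ver_val s * c = 0.
  have /(congr1 (fun q : {poly R} => q`_(e + i))) := congr1 (homogenization gR) sa0.
  rewrite rmorphM (homogenization_form gR is_) rmorph0 coef0 -mulrA [_ * homogenization gR a]mulrC.
  by rewrite coefCM coefMXn ltnNge leq_addl /= addnK.
have cd : c ^+ d \in @veronese_pred _ _ R d.
  by apply: (@veronese_form _ _ _ _ e); rewrite mulnC; apply: formX.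
apply: (redR (e := d)); suff : Veronese cd = 0 by move=> /(congr1 val).
apply: regs; apply: val_inj; rewrite /= mulr0.
have -> : c ^+ d = c * c ^+ d.-1 by rewrite -exprS prednK.
by rewrite mulrA sc0 mul0r.
Qed.

(* Multiplying by (h_1/h_2)^l, where h_1 and h_2 are regular forms of k[f] of
   consecutive degrees, moves R_(ld) into degree zero. *)
Lemma veronese_fraction l a : fractions_lift f -> form R (l * d) a ->
  exists i j (u v : S), [/\ form S i u, form S j v, GRing.lreg v & a * sub_val v = sub_val u].
Proof.
move=> lift la; have [M regS] := exists_regular_forms gS redS (image_irrelevant redR hf).
have [h1 Mh1 regh1] := regS _ (leqnn M); have [h2 Mh2 regh2] := regS _ (leqnSn M).
have sh1 : form R (l * M * d) (sub_val (h1 ^+ l)).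
  by apply: (image_alg_deg hf); apply: formX.
have sh2 : form R (l * M.+1 * d) (sub_val (h2 ^+ l)).
  by apply: (image_alg_deg hf); apply: formX.
have [|||N [b [t [Nb Nt regt E]]]] := lift (l * M.+1 * d)%N (a * sub_val (h1 ^+ l)) (sub_val (h2 ^+ l)).
- by rewrite mulnS mulnDl; apply: formM.
- exact: sh2.
- by apply: (image_alg_reg redR hf); apply: lregX.
exists (N + l * M.+1)%N, (l * M + N)%N, (b * h2 ^+ l), (h1 ^+ l * t); split.
- by apply: formM => //; apply: formX.
- by apply: formM => //; apply: formX.
- by apply: lregM; [apply: lregX|apply: image_alg_lreg].
- by rewrite !sub_valM mulrA.
Qed.

Lemma fractions_lift_K : fractions_lift f -> bijective (induced_K redR hf).
Proof.
move=> lift; apply: inj_surj_bijective => [|y].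
  by apply: Kmap_inj => s t /(congr1 val) /= /val_inj.
pose im x := exists w, induced_K redR hf w = x.
have imD x x' : im x -> im x' -> im (x + x').
  by move=> [w <-] [w' <-]; exists (w + w'); rewrite rmorphD.
have imM x x' : im x -> im x' -> im (x * x').
  by move=> [w <-] [w' <-]; exists (w * w'); rewrite rmorphM.
have [a [s ->]] := HFrac.fracP y.
(* The image is closed under sums and products, so it is enough to reach a/1 for forms [a] and 1/s.
   Clearing denominators as [s * v = u] turns 1/s into v/u. *)
have -> : hfrac a s = hfrac a (HFrac.den1 _) * hfrac 1 s.
  by rewrite HFrac.fracM; apply/HFrac.fracE; rewrite /= mul1r mulr1.
apply: imM.
- case: a => a ha; have /asboolP[cs csP aE] := ha.
  elim: cs a aE ha csP => [|c cs IHcs] a aE ha csP.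
    exists 0; rewrite rmorph0; apply/HFrac.fracE; rewrite /= mul0r mulr1.
    by apply: val_inj; rewrite /= aE big_nil.
  have csP' : forall c', c' \in cs -> exists i, form R (i * d) c'.
    by move=> c' c'cs; apply: csP; rewrite inE c'cs orbT.
  have ha' : \sum_(c' <- cs) c' \in @veronese_pred _ _ R d by apply/asboolP; exists cs.
  have [l lc] := csP c (mem_head _ _); have hc := veronese_form lc.
  have -> : hfrac (Veronese ha) (HFrac.den1 _) =
      hfrac (Veronese hc) (HFrac.den1 (ver_grading R d)) + hfrac (Veronese ha') (HFrac.den1 _).
    rewrite HFrac.fracD; apply/HFrac.fracE; rewrite /= !mulr1.
    by apply: val_inj; rewrite /= aE big_cons.
  apply: imD; last exact: IHcs.
  have [i [j [u [v [iu jv regv E]]]]] := veronese_fraction lift lc.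
  have hv : hreg (std_grading S) v by split=> //; exists j.
  exists (hfrac u (HFrac.mkden hv)); rewrite [LHS]KmapE; apply/HFrac.fracE.
  by apply: val_inj; rewrite /= mulr1 E.
- have [[l ls] regs] := HFrac.denP s.
  have [i [j [u [v [iu jv regv E]]]]] := veronese_fraction lift ls.
  have hu : hreg (std_grading S) u.
    split; first by exists i.
    apply: image_alg_lreg; rewrite -E; apply: lregM; first exact: veronese_reg ls regs.
    exact: (image_alg_reg redR hf).
  exists (hfrac v (HFrac.mkden hu)); rewrite [LHS]KmapE; apply/HFrac.fracE.
  by apply: val_inj; rewrite /= mul1r mulrC E.
Qed.

(** The fraction a/s is rewritten with numerator [a * s ^+ d.-1] and denominator [s ^+ d], whose
    degrees are multiples of [d]. The numerator of a preimage need not be homogeneous, hence the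
    final use of [fraction_component]. *)
Lemma K_fractions_lift : bijective (induced_K redR hf) -> fractions_lift f.
Proof.
move=> [inv _ invK] e a s ea es regs.
have sd : form R (e * d) (s ^+ d) by rewrite mulnC; apply: formX.
have ad : form R (e * d) (a * s ^+ d.-1).
  by rewrite -[in X in form R X](prednK d0) mulnS; apply: formM => //; rewrite mulnC; apply: formX.
have hs : hreg (ver_grading R d) (Veronese (veronese_form sd)).
  split; first by exists e.
  move=> u v /(congr1 val) /= uv; apply: val_inj.
  have regsd : GRing.lreg (s ^+ d) by apply: lregX.
  exact: regsd.
pose y := hfrac (Veronese (veronese_form ad)) (HFrac.mkden hs).
have := invK y; have [b [t ->]] := HFrac.fracP (inv y).
rewrite [induced_K _ _ _]KmapE => /HFrac.fracE /(congr1 val) /= E.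
have [[N Nt] regt] := HFrac.denP t.
have {}E : a * sub_val (den_val t) = sub_val b * s.
  have regsd : GRing.lreg (s ^+ d.-1) by apply: lregX.
  apply: regsd; move: E; rewrite -{1}(prednK d0) exprS => E.
  transitivity (a * s ^+ d.-1 * sub_val (den_val t)); first by ring.
  by rewrite -E; ring.
have [b' Nb' E'] := fraction_component gR hf ea es Nt E.
by exists N, b', (den_val t); split=> //; apply: (image_alg_reg redR hf).
Qed.

End InducedIsomorphisms.

(** * Restriction to an irreducible component *)

Section Restriction.
Variables (k : fieldType) (n : nat) (R : galg k n) (P : prime_idealr R).
Local Notation RP := (quotient_alg R P).
Local Notation pi := (\pi_{ideal_quot P}).

Definition quotient_alg_pi : {rmorphism R -> RP} := pi.

Lemma quotient_alg_pi_eq0 a : (quotient_alg_pi a == 0) = (a \in P).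
Proof. by rewrite -(rmorph0 quotient_alg_pi) /= -Quotient.idealrBE subr0. Qed.

Lemma quotient_alg_pi_form e a : form R e a -> form RP e (quotient_alg_pi a).
Proof. by move=> [p hp <-]; exists p. Qed.

Lemma quotient_alg_domain (x y : RP) : x * y = 0 -> (x == 0) || (y == 0).
Proof. exact: (@Quotient.rquot_IdomainAxiom _ P). Qed.

Lemma quotient_alg_pi_lreg a : a \notin P -> GRing.lreg (quotient_alg_pi a).
Proof. by move=> aP; apply: (domain_lreg quotient_alg_domain); rewrite quotient_alg_pi_eq0. Qed.

Lemma restrict_aeval m (f : 'I_m.+1 -> R) p :
  aeval (restrict f P) p = quotient_alg_pi (aeval f p).
Proof. by rewrite (rmorph_mmap quotient_alg_pi). Qed.

End Restriction.

(** * Irreducible components *)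

Section Components.
Variables (k : fieldType) (n m d : nat) (R : galg k n).
Hypotheses (gR : homogeneous_presentation R) (redR : reduced R).
Variable f : 'I_m.+1 -> R.
Hypothesis hf : rational_datum R f d.
Local Notation S := (image_alg f).

Let d0 : (0 < d)%N := datum_deg hf.
Let fd : forall j, form R d (f j) := datum_form hf.
Let gS : homogeneous_presentation S := image_alg_graded gR d0 fd.
Let redS : reduced S := image_alg_reduced redR.

(** Up to powers of the regular [F] and [F'], a form p(x) equals p(g(f)), an element of k[f]; so its
    membership in a minimal prime is decided by the contraction. *)
Lemma birational_contraction_sub (P Q : {pred R}) : birational f ->
    minimal_prime P -> minimal_prime Q ->
    contraction (f := f) P =i contraction (f := f) Q ->
  {subset P <= Q}.
Proof.
move=> [e [g [_ [F [F' [[_ regF] [_ regF'] FE]]]]]] minP minQ PQ z zP.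
have [prQ _] := minQ; have [prP _] := minP.
rewrite -(sum_homogenization gR z); apply: prime_ideal_sum => // l _.
have : (homogenization gR z)`_l \in P by apply: minimal_prime_homogeneous.
have [p hp <-] := coef_homogenization gR z l; rewrite -aeval_gen => pP.
have E := aeval_proportional hp FE; rewrite -sub_val_aeval in E.
have : F ^+ l * aeval (gen R) p \in Q.
  rewrite E prime_idealM //; apply/orP; right; apply: etrans (esym (PQ (aeval g p))) _.
  have : F' ^+ l * sub_val (aeval g p) \in P by rewrite -E prime_idealM // pP orbT.
  rewrite prime_idealM // (negPf (prime_idealX_notin _ _ _)) //.
  exact: reg_notin_minimal_prime regF'.
rewrite prime_idealM // (negPf (prime_idealX_notin _ _ _)) //.
exact: reg_notin_minimal_prime regF.
Qed.

(** The inverse is reduced modulo [P]; [F] and [F'] remain nonzero there. All rings involved are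
    domains, so minimal primes are zero and torsionfreeness is immediate. *)
Lemma birational_restrict (P : prime_idealr R) : birational f ->
  minimal_prime (P : {pred R}) -> birational (restrict f P).
Proof.
move=> [e [g [[e0 ge _ _] [F [F' [[[i iF] regF] [[i' iF'] regF'] FE]]]]]] minP.
have FP : F \notin P by apply: reg_notin_minimal_prime regF.
have F'P : F' \notin P by apply: reg_notin_minimal_prime regF'.
have /choice[p pP] j : exists p, p \is e.-homog /\ galg_pres S p = g j.
  by have [p] := ge j; exists p.
pose SP := image_alg (restrict f P).
pose g' j : SP := galg_pres SP (p j).
have g'E j : sub_val (g' j) = quotient_alg_pi P (sub_val (g j)).
  by have [_ <-] := pP j; apply: restrict_aeval.
have F'E j : quotient_alg_pi P F * gen (quotient_alg R P) j =
    quotient_alg_pi P F' * sub_val (g' j).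
  by rewrite g'E -rmorphM -FE rmorphM.
have domSP := image_alg_domain (f := restrict f P) (@quotient_alg_domain _ _ _ P).
exists e, g'; split; last first.
  exists (quotient_alg_pi P F), (quotient_alg_pi P F'); split=> //.
    by split; [exists i; apply: quotient_alg_pi_form|apply: quotient_alg_pi_lreg].
  by split; [exists i'; apply: quotient_alg_pi_form|apply: quotient_alg_pi_lreg].
split=> // [j|Q minQ|Q minQ g'Q].
- by have [hp _] := pP j; exists (p j).
- have Q0 := domain_minimal_prime0 domSP minQ.
  apply: (domain_pred0_minimal_prime (image_alg_domain domSP)) => z.
  by transitivity (image_alg_val g' z \in Q); rewrite // Q0 !inE.
(* If all reduced [g' j] vanished, every [F * gen R j], hence every generator, would lie in [P]. *)
- have [j /negP] := source_irrelevant hf minP; apply.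
  have := g'Q j; rewrite (domain_minimal_prime0 domSP minQ) => /eqP g'0.
  have /eqP := F'E j; rewrite g'0 [sub_val 0]/(0 : quotient_alg R P) mulr0.
  have -> : gen (quotient_alg R P) j = quotient_alg_pi P (gen R j) by [].
  by rewrite -rmorphM quotient_alg_pi_eq0 prime_idealrM (negPf FP).
Qed.

(* Uniqueness of P over Q makes P the only minimal prime of R disjoint from the
   multiplicative set of homogeneous elements of k[f] outside Q. *)
Lemma unique_contraction_ann (P : {pred R}) (Q : {pred S}) z :
    minimal_prime P -> minimal_prime Q -> (forall a : S, (sub_val a \in P) = (a \in Q)) ->
    (forall P' : {pred R}, minimal_prime P' ->
       contraction (f := f) P' =i contraction (f := f) P -> P' =i P) ->
    z \in P ->
  exists e (u : S), [/\ form S e u, u \notin Q & sub_val u * z = 0].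
Proof.
move=> minP minQ PQ uniqP zP; have [prQ minQ'] := minQ; apply: contrapT => noann.
pose M x := exists e (u : S), [/\ form S e u, u \notin Q & x = sub_val u].
have [|_ _ [e [u [eu uQ ->]]] [e' [v [ev vQ ->]]]|_ [e [u [eu uQ ->]]] uz0|P' minP' [MP' zP']] :=
  @exists_minimal_prime_avoiding _ M z redR.
- by exists 0%N, 1; split; rewrite ?prime_ideal1 //; apply: form1.
- exists (e + e')%N, (u * v); split; [exact: formM| |exact: sub_valM].
  by rewrite prime_idealM // negb_or uQ vQ.
- by apply: noann; exists e, u.
have minC : minimal_prime (contraction (f := f) P') := datum_torsionfree hf minP'.
(* [P'] avoids only the homogeneous elements outside [Q]; the contraction, being a minimal prime, is
   homogeneous, so this suffices. *)
have subQ : {subset contraction (f := f) P' <= Q}.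
  move=> x xP'; rewrite -(sum_homogenization gS x); apply: prime_ideal_sum => // l _.
  have : (homogenization gS x)`_l \in contraction (f := f) P'.
    exact: minimal_prime_homogeneous.
  apply: contraLR => xlQ; apply: MP'; exists l, (homogenization gS x)`_l.
  by split=> //; apply: coef_homogenization.
move: zP'; rewrite (uniqP P') ?zP // => x; apply/idP/idP => [/subQ|].
  by rewrite -PQ.
move=> xP; apply: (minQ' _ (proj1 minC) subQ).
by rewrite -PQ.
Qed.

(** The admissible denominators [t] form an ideal [I] of [S]. It has a form outside each minimal
    prime, so prime avoidance finds one regular form in it. *)
Lemma componentwise_fractions_lift :
  (forall P : prime_idealr R, minimal_prime (P : {pred R}) ->
     birational (restrict f P) /\
     (forall Q : {pred R}, minimal_prime Q ->
        contraction (f := f) Q =i contraction (f := f) (P : {pred R}) -> Q =i P)) ->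
  fractions_lift f.
Proof.
move=> birP e a s ea es regs.
pose I (t : S) := exists b : S, a * sub_val t = sub_val b * s.
have idI : ideal_like I.
  split; first by exists 0; rewrite mulr0 mul0r.
    by move=> x y [b Eb] [b' Eb']; exists (b + b'); rewrite mulrDr mulrDl Eb Eb'.
  by move=> c x [b Eb]; exists (c * b); rewrite !sub_valM mulrCA Eb mulrA.
have [Q minQ|N0 N0P] := homogeneous_prime_avoidance gS redS (image_irrelevant redR hf) idI.
  have [P minP PQ] := minimal_prime_image_lift redR minQ.
  have [prP _] := minP; pose PI : prime_idealr R := prime_pred prP.
  have [bir uniqP] := birP PI minP.
  have sP : s \notin PI by apply: reg_notin_minimal_prime regs.
  have [N [_ [_ [[p hp <-] [q hq <-] regt E]]]] := birational_fractions_lift bir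
    (quotient_alg_pi_form PI ea) (quotient_alg_pi_form PI es) (quotient_alg_pi_lreg sP).
  (* The solution on the component is lifted to [S] through polynomials, leaving a defect in [P]. *)
  pose b := galg_pres S p; pose t := galg_pres S q.
  have bE : sub_val (galg_pres (image_alg (restrict f PI)) p) = quotient_alg_pi PI (sub_val b).
    exact: restrict_aeval.
  have tE : sub_val (galg_pres (image_alg (restrict f PI)) q) = quotient_alg_pi PI (sub_val t).
    exact: restrict_aeval.
  rewrite bE tE -!rmorphM in E regt.
  have zP : a * sub_val t - sub_val b * s \in PI.
    by rewrite -quotient_alg_pi_eq0 rmorphB E subrr.
  have tQ : t \notin Q.
    rewrite -PQ; apply/negP => tP; have : sub_val t \in PI by [].
    rewrite -quotient_alg_pi_eq0 => /eqP t0; move: regt; rewrite t0 => /(_ 1 0).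
    by rewrite !mul0r => /(_ erefl)/eqP; rewrite oner_eq0.
  have [e' [u [e'u uQ uz0]]] := unique_contraction_ann minP minQ PQ uniqP zP.
  (* The factor [u] kills the defect and stays outside [Q]. *)
  exists (e' + N)%N, (u * t); split.
  - by apply: formM => //; exists q.
  - exists (u * b); rewrite !sub_valM; apply/eqP; rewrite -subr_eq0 -uz0; apply/eqP; ring.
  - by rewrite prime_idealM ?negb_or ?uQ //; case: minQ.
have [t [Nt [b E] tQ]] := N0P _ (leqnn N0).
have [b' Nb' E'] := fraction_component gR hf ea es Nt E.
exists N0, b', t; split=> //; apply: (image_alg_reg redR hf).
exact: reg_of_minimal_primes.
Qed.

End Components.

Theorem proposition1p11 (k : fieldType) (n m d : nat) (R : galg k n)
    (graded_R : homogeneous_presentation R)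
    (reduced_R : reduced R)
    (dim_R : krull_dim_ge R 1)
    (f : 'I_m.+1 -> R)
    (datum_f : rational_datum R f d) :
  [<-> birational f;
       forall P : prime_idealr R, minimal_prime (P : {pred R}) ->
         birational (restrict f P) /\
         (forall Q : {pred R}, minimal_prime Q ->
            contraction (f := f) Q =i contraction (f := f) (P : {pred R}) ->
            Q =i P);
       bijective (induced_K0 reduced_R datum_f);
       bijective (induced_K reduced_R datum_f)].
Proof.
tfae.
- move=> bir P minP; split; first exact: (birational_restrict reduced_R datum_f bir minP).
  move=> Q minQ QP x; apply/idP/idP.
    exact: (birational_contraction_sub graded_R reduced_R bir minQ minP QP).
  apply: (birational_contraction_sub graded_R reduced_R bir minP minQ) => y.
  by rewrite QP.
- by move=> /(componentwise_fractions_lift graded_R reduced_R datum_f)/fractions_lift_K0.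
- by move=> /K0_fractions_lift/(fractions_lift_K graded_R).
- by move=> /(K_fractions_lift graded_R)/(fractions_lift_birational graded_R reduced_R datum_f).
Qed.
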